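(* Assume that $D_n\ne0$ for all $n\geq 1$, so that the biorthogonal sections $\psi_n,\psi_n^\vee$ span $\mathscr P_n$ mod $\mathscr P_{n-1}$ and $\mathscr P_n^\vee$ mod $\mathscr P_{n-1}^\vee$ respectively, and let $h_n=\langle\psi_n,\psi_n^\vee\rangle$. Let $P_k(z),P_k^\vee(z)$ ($k\ge0$) be the $r\times r$ matrix polynomials of degree $k$ determined by $$\Psi_k(z)=P_k(z)\Phi(z),\qquad \Psi_k^\vee(z)=\Phi^\vee(z)P_k^\vee(z).$$ Then $\{P_k\}_{k\ge0},\{P_k^\vee\}_{k\ge0}$ are a biorthogonal sequence for the matrix weight $W(z)\,\mathrm dz$: $$\int_{\gamma_0}P_k(z)W(z)P_\ell^\vee(z)\,\mathrm dz=\delta_{\ell k}\mathbf H_\ell,\qquad \mathbf H_\ell=\mathrm{diag}\big(h_{\ell r},\dots,h_{\ell r+r-1}\big).$$ The two sequences can be normalized to be monic by $$Q_k(z)=\big(F_k^{(k)}\big)^{-1}P_k(z),\qquad Q_k^\vee(z)=P_k^\vee(z)\big(F_k^{\vee(k)}\big)^{-1},$$ where the leading coefficients $F_k^{(k)}$ and $F_k^{\vee(k)}$ of $P_k$ and $P_k^\vee$ (coefficients of $z^k$) are invertible, and in this case $$\int_{\gamma_0}Q_k(z)W(z)Q_\ell^\vee(z)\,\mathrm dz=\delta_{\ell k}\widetilde{\mathbf H}_\ell,\qquad \widetilde{\mathbf H}_\ell=\big(F_\ell^{(\ell)}\big)^{-1}\mathbf H_\ell\big(F_\ell^{\vee(\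ell)}\big)^{-1}.$$
   Context: $\mathcal C$ is a compact Riemann surface of genus $g$ with canonical bundle $\mathcal K$, and $\sqrt{\mathcal K}$ is a fixed holomorphic square root of $\mathcal K$ with $h^0(\sqrt{\mathcal K})=0$. $\mathcal X$ is a flat line bundle given by a unitary character $\mathcal X:\pi_1(\mathcal C)\to U(1)$, and $\mathcal X^\vee$ is the dual one (inverse character); standing assumption: $h^0(\mathcal X\otimes\sqrt{\mathcal K})=0$ (hence also $h^0(\mathcal X^\vee\otimes\sqrt{\mathcal K})=0$). For a divisor $\mathscr D$, $H^0(\mathcal X\otimes\sqrt{\mathcal K}(\mathscr D))$ is the space of meromorphic sections $\varphi$ of $\mathcal X\otimes\sqrt{\mathcal K}$ with $\mathrm{div}(\varphi)\ge-\mathscr D$. $Z:\mathcal C\to\mathbb C\mathbb P^1$ is a meromorphic function of degree $r$ with polar divisor $\Xi$. $\mathscr D_n$ ($n\ge0$) is a strictly increasing sequence of positive divisors, $\deg\mathscr D_n=n$, of the form $\mathscr D_{kr+\ell}=k\Xi+\mathscr R_\ell$, $0\le\ell\le r-1$, with $\mathscr R_\ell\le\Xi$ a positive divisor of degree $\ell$. Set $\mathscr P_n:=H^0(\mathcal X\otimes\sqrt{\mathcal K}(\mathscr D_{n+1}))$, $\mathscr P_n^\vee:=H^0(\mathcal X^\vee\otimes\sqrt{\mathcal K}(\mathscr D_{n+1}))$ (dimension $n+1$; $\mathscr P_{-1}=\mathscr P_{-1}^\vee=\{0\}$). $\gamma_0\subset\mathbb C$ is an oriented contour and $\gamma=Z^{-1}(\gamma_0)\subset\mathcal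 C$ with the orientation pulled back from $\gamma_0$; $Y:\gamma\to\mathbb C$ is a smooth function (all integrals are assumed convergent). The pairing of sections is $\langle\varphi,\varphi^\vee\rangle=\int_\gamma Y\varphi\varphi^\vee$. Fix sequences $\chi_n$ spanning $\mathscr P_n$ mod $\mathscr P_{n-1}$ and $\chi_n^\vee$ spanning $\mathscr P_n^\vee$ mod $\mathscr P_{n-1}^\vee$, and set $D_n=\det[\langle\chi_a,\chi_b^\vee\rangle]_{a,b=0}^{n-1}$ (nonvanishing of $D_n$ does not depend on the choice). A nonzero $\psi_n\in\mathscr P_n$ is a biorthogonal section if $\langle\psi_n,\varphi^\vee\rangle=0$ for all $\varphi^\vee\in\mathscr P_{n-1}^\vee$; a nonzero $\psi_n^\vee\in\mathscr P_n^\vee$ is biorthogonal if $\langle\varphi,\psi_n^\vee\rangle=0$ for all $\varphi\in\mathscr P_{n-1}$; thus $\langle\psi_n,\psi_m^\vee\rangle=\delta_{nm}h_n$. The points $z^{(1)},\dots,z^{(r)}$ are the points of $Z^{-1}(z)$, labelled on the complement of a dissection of the $z$-plane. Let $\{\varphi_\ell\}_{\ell=1}^r$, $\{\varphi_\ell^\vee\}_{\ell=1}^r$ be arbitrary bases of $H^0(\mathcal X\otimes\sqrt{\mathcal K}(\Xi))$ and $H^0(\mathcal X^\vee\otimes\sqrt{\mathcal K}(\Xi))$, and set $\Phi_{ab}(z)=\varphi_a(z^{(b)})$, $\Phi^\vee_{ab}(z)=\varphi^\vee_b(z^{(a)})$, $(\Psi_k(z))_{ab}=\psi_{rk+a-1}(z^{(b)})$,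 $(\Psi_k^\vee(z))_{ab}=\psi^\vee_{rk+b-1}(z^{(a)})$, $a,b=1,\dots,r$. (It is known that matrix polynomials $P_k,P_k^\vee$ of degree $k$ with $\Psi_k=P_k\Phi$, $\Psi_k^\vee=\Phi^\vee P_k^\vee$ exist and are unique.) The matrix weight on $\gamma_0$ is defined by $$W(z)\,\mathrm dz:=\Phi(z)\Lambda(z)\Phi^\vee(z),\qquad \Lambda(z)=\mathrm{diag}\big(Y(z^{(1)}),\dots,Y(z^{(r)})\big),$$ i.e. $W_{ab}(z)\,\mathrm dz=\sum_{j=1}^r\varphi_a(z^{(j)})Y(z^{(j)})\varphi_b^\vee(z^{(j)})$, where each term is a differential on $\mathcal C$ expressed through $\mathrm dz$ by means of $z=Z(p)$ on the $j$-th sheet. *)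

(* Defs.v *)
From HB Require Import structures.
From mathcomp Require Import all_boot all_order all_algebra.
From mathcomp Require Import finmap complex.
From mathcomp Require Import all_classical all_reals all_analysis.
Set Implicit Arguments.
Unset Strict Implicit.
Unset Printing Implicit Defensive.
Import Order.TTheory GRing.Theory Num.Theory numFieldNormedType.Exports.
Local Open Scope ring_scope.
Local Open Scope classical_set_scope.

(* R[i] seen as a numFieldType only: this selects the topology and the normed
   module structure that MathComp-Analysis puts on every numFieldType.  The
   one-variable notions below are stated for an abstract numFieldType. *)
Definition Cplx (R : realType) : numFieldType := R[i]%C.

Section OneVariable.
Variable K : numFieldType.
Implicit Types (f h : K -> K) (w : K) (m : int).

Definition holomorphic_at f w : Prop := \forall z \near w, derivable f z 1.

(* "f is meromorphic at w, of order at least m", resp. "exactly m".  The value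
   of f at w itself is irrelevant; f vanishing near w has order_ge every m. *)
Definition order_ge f w m : Prop :=
  exists h, holomorphic_at h w /\
    \forall z \near w^', f z = (z - w) ^ m * h z.

Definition order_eq f w m : Prop :=
  exists h, [/\ holomorphic_at h w, h w != 0 &
    \forall z \near w^', f z = (z - w) ^ m * h z].

End OneVariable.

Section RealToComplex.
Variable R : realType.
Local Notation C := (Cplx R).
Implicit Types (f : R -> C) (t : R) (A : set R).

Definition re_part f : R -> R := fun t => complex.Re (f t).
Definition im_part f : R -> R := fun t => complex.Im (f t).

Definition smooth_at f t : Prop :=
  forall n, derivable ((re_part f)^`(n)) t 1 /\
            derivable ((im_part f)^`(n)) t 1.

Definition velocity f t : C :=
  ((re_part f)^`() t +i* (im_part f)^`() t)%C.

Definition cintegrable A f : Prop :=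
  (@lebesgue_measure R).-integrable A (EFin \o re_part f) /\
  (@lebesgue_measure R).-integrable A (EFin \o im_part f).

Definition cintegral A f : C :=
  (Rintegral (@lebesgue_measure R) A (re_part f) +i*
   Rintegral (@lebesgue_measure R) A (im_part f))%C.

(* A finite family of parametrised oriented arcs in T; the domains may be
   open, closed, or unbounded. *)
Record contour (T : Type) := Contour {
  contour_arc : finType;
  arc_span : contour_arc -> interval R;
  arc_path : contour_arc -> R -> T
}.

Definition piecewise_smooth_contour (g : contour C) : Prop :=
  forall a : contour_arc g,
    {within [set` arc_span a], continuous (arc_path a)} /\
    exists E : seq R, forall t, interior [set` arc_span a] t -> t \notin E ->
      smooth_at (arc_path a) t /\ velocity (arc_path a) t != 0.

(* The differential F(z) dz along a contour in the plane. *)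
Definition plane_integrable (g : contour C) (F : C -> C) : Prop :=
  forall a : contour_arc g, cintegrable [set` arc_span a]
    (fun t => F (arc_path a t) * velocity (arc_path a) t).

Definition plane_integral (g : contour C) (F : C -> C) : C :=
  \sum_(a : contour_arc g) cintegral [set` arc_span a]
    (fun t => F (arc_path a t) * velocity (arc_path a) t).

End RealToComplex.

Section MatrixPolynomials.
Variables (K : fieldType) (r : nat).
Implicit Types P : 'M[{poly K}]_r.

Definition mxpoly_eval P (z : K) : 'M[K]_r := \matrix_(a, b) (P a b).[z].
Definition mxpoly_coef (k : nat) P : 'M[K]_r := \matrix_(a, b) (P a b)`_k.
Definition mxpoly_const (A : 'M[K]_r) : 'M[{poly K}]_r :=
  \matrix_(a, b) (A a b)%:P.
Definition mxpoly_deg_le (k : nat) P : Prop :=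
  forall a b, (size (P a b) <= k.+1)%N.
Definition mxpoly_monic (k : nat) P : Prop :=
  mxpoly_deg_le k P /\ mxpoly_coef k P = 1%:M.

End MatrixPolynomials.

(* Compact (connected, Hausdorff) Riemann surfaces.  [param i] inverts the
   coordinate [coord i] on its image and is arbitrary elsewhere; [chart_at]
   selects one chart around each point. *)
Record compact_riemann_surface (R : realType) (M : topologicalType) :=
  CompactRiemannSurface {
  surface_compact : compact [set: M];
  surface_hausdorff : hausdorff_space M;
  surface_connected : connected [set: M];
  chart : Type;
  dom : chart -> set M;
  coord : chart -> M -> Cplx R;
  param : chart -> Cplx R -> M;
  chart_at : M -> chart;
  dom_open : forall i, open (dom i);
  dom_chart_at : forall p, dom (chart_at p) p;
  coord_open : forall i, open (coord i @` dom i);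
  coordK : forall i p, dom i p -> param i (coord i p) = p;
  coord_continuous : forall i p, dom i p -> {for p, continuous (coord i)};
  param_continuous : forall i p, dom i p ->
    {for coord i p, continuous (param i)};
  transition_holomorphic : forall i j p, dom i p -> dom j p ->
    holomorphic_at (coord j \o param i) (coord i p)
}.

Section Surface.
Variables (R : realType) (M : topologicalType).
Variable S : compact_riemann_surface R M.
Local Notation C := (Cplx R).
Local Notation chart := (chart S).
Local Notation dom := (@dom R M S).
Local Notation coord := (@coord R M S).
Local Notation param := (@param R M S).
Local Notation chart_at := (@chart_at R M S).

(* Line bundles are given by transition functions over the atlas: a section is
   a family (phi i) of functions on the chart domains such that
   phi i = g i j * phi j on overlaps. *)
Definition transition := chart -> chart -> M -> C.
Definition bundle_section := chart -> M -> C.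

Record line_bundle (g : transition) : Prop := {
  bundle_neq0 : forall i j p, dom i p -> dom j p -> g i j p != 0;
  bundle_refl : forall i p, dom i p -> g i i p = 1;
  bundle_cocycle : forall i j k p, dom i p -> dom j p -> dom k p ->
    g i j p * g j k p = g i k p;
  bundle_holomorphic : forall i j p, dom i p -> dom j p ->
    holomorphic_at (g i j \o param i) (coord i p)
}.

Definition tensor_bundle (g g' : transition) : transition :=
  fun i j p => g i j p * g' i j p.
Definition dual_bundle (g : transition) : transition := fun i j p => (g i j p)^-1.

(* f_i dx_i = f_j dx_j, i.e. f_i = (dx_j / dx_i) f_j. *)
Definition canonical_bundle : transition :=
  fun i j p => derive1 (coord j \o param i) (coord i p).

Definition canonical_root (s : transition) : Prop :=
  line_bundle s /\
  forall i j p, dom i p -> dom j p -> s i j p ^+ 2 = canonical_bundle i j p.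

(* Characters of the fundamental group, as homotopy-invariant multiplicative
   functions of loops [0, 1] -> M. *)
Definition loop_at (p0 : M) (l : R -> M) : Prop :=
  [/\ {within `[0, 1], continuous l}, l 0 = p0 & l 1 = p0].

Definition loop_concat (l l' : R -> M) : R -> M :=
  fun t => if t <= 2^-1 then l (2 * t) else l' (2 * t - 1).

Definition loop_homotopic (p0 : M) (l l' : R -> M) : Prop :=
  exists H : R * R -> M,
    [/\ {within `[0, 1] `*` `[0, 1], continuous H},
        forall t, t \in `[0, 1] -> H (0, t) = l t /\ H (1, t) = l' t &
        forall u, u \in `[0, 1] -> H (u, 0) = p0 /\ H (u, 1) = p0].

Record unitary_character (p0 : M) (X : (R -> M) -> C) : Prop := {
  character_unitary : forall l, loop_at p0 l -> `|X l| = 1;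
  character_concat : forall l l', loop_at p0 l -> loop_at p0 l' ->
    X (loop_concat l l') = X l * X l';
  character_homotopy : forall l l', loop_at p0 l -> loop_at p0 l' ->
    loop_homotopic p0 l l' -> X l = X l'
}.

(* The flat line bundle of the character X: unitary locally constant
   transition functions, such that parallel transport along each loop l is
   multiplication by X l ([u i t] is the component in chart i of a parallel
   section along l). *)
Record flat_bundle (p0 : M) (X : (R -> M) -> C) (g : transition) : Prop := {
  flat_line_bundle : line_bundle g;
  flat_unitary : forall i j p, dom i p -> dom j p -> `|g i j p| = 1;
  flat_locally_constant : forall i j p, dom i p -> dom j p ->
    \forall q \near p, g i j q = g i j p;
  flat_holonomy : forall l, loop_at p0 l ->
    exists u : chart -> R -> C,
      [/\ forall i t, t \in `[0, 1] -> dom i (l t) -> u i t != 0 /\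
            \forall t' \near within `[0, 1] (nbhs t), u i t' = u i t,
          forall i j t, t \in `[0, 1] -> dom i (l t) -> dom j (l t) ->
            u i t = g i j (l t) * u j t &
          forall i, dom i p0 -> u i 1 = X l * u i 0]
}.

Definition divisor := {fsfun M -> int with 0%R}.
Definition div_degree (D : divisor) : int := \sum_(p <- finsupp D) D p.

(* Meromorphic sections phi of g with div phi >= - D.  At points where
   D p <= 0 the section is holomorphic and its value is the true one; at points
   where D p > 0 its value is arbitrary.  Hence sections have to be compared
   with [sec_eq] and not with Leibniz equality. *)
Definition H0 (g : transition) (D : divisor) : set bundle_section :=
  [set phi |
    (forall i j p, dom i p -> dom j p -> phi i p = g i j p * phi j p) /\
    (forall i p, dom i p ->
       order_ge (phi i \o param i) (coord i p) (- D p) /\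
       (D p <= 0 -> holomorphic_at (phi i \o param i) (coord i p)))].

Definition sec_eq (phi phi' : bundle_section) : Prop :=
  forall i p, dom i p -> \forall q \near p^', phi i q = phi' i q.

Definition sec0 : bundle_section := fun _ _ => 0.

Definition lincomb (n : nat) (c : 'I_n -> C) (phi : 'I_n -> bundle_section) :
    bundle_section :=
  fun i p => \sum_(a < n) c a * phi a i p.

Definition h0_eq0 (g : transition) : Prop :=
  forall D : divisor, (forall p, D p = 0) ->
  forall phi, H0 g D phi -> sec_eq phi sec0.

Definition is_basis (n : nat) (phi : 'I_n -> bundle_section)
    (V : set bundle_section) : Prop :=
  [/\ forall a, V (phi a),
      forall c, sec_eq (lincomb c phi) sec0 -> forall a, c a = 0 &
      forall eta, V eta -> exists c, sec_eq eta (lincomb c phi)].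

Definition spans_mod (chi : bundle_section) (V V' : set bundle_section) : Prop :=
  V chi /\
  forall phi, V phi -> exists (c : C) (eta : bundle_section),
    V' eta /\ sec_eq phi (fun i p => c * chi i p + eta i p).

(* Functions to the Riemann sphere; None is the point at infinity. *)
Definition sphere := one_point_compactification C.
Definition finite_part (Z : M -> sphere) : M -> C := fun p => odflt 0 (Z p).

Record meromorphic_function (Z : M -> sphere) (Xi : divisor) : Prop := {
  polar_ge0 : forall p, 0 <= Xi p;
  polar_support : forall p, Z p = None <-> 0 < Xi p;
  meromorphic_regular : forall i p, dom i p -> Z p <> None ->
    holomorphic_at (finite_part Z \o param i) (coord i p);
  meromorphic_pole : forall i p, dom i p -> Z p = None ->
    order_eq (finite_part Z \o param i) (coord i p) (- Xi p)
}.

(* The points x 0, ..., x (r - 1) are the points of the fibre of Z over the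
   finite value z, each repeated according to its multiplicity. *)
Definition enumerates_fibre (Z : M -> sphere) (r : nat) (z : C)
    (x : 'I_r -> M) : Prop :=
  (forall j, Z (x j) = Some z) /\
  (forall i p, dom i p -> Z p = Some z ->
     order_eq (fun w => finite_part Z (param i w) - z) (coord i p)
              #|[pred j | x j == p]|%:Z).

(* z^(1), ..., z^(r): continuous off the dissection [cut]; on [cut] the fibre is
   listed in an arbitrary order. *)
Definition sheet_labelling (Z : M -> sphere) (r : nat) (cut : set C)
    (sheet : C -> 'I_r -> M) : Prop :=
  [/\ closed cut, interior cut = set0,
      forall z, enumerates_fibre Z z (sheet z) &
      forall z j, ~ cut z -> {for z, continuous (fun w => sheet w j)}].

(* gamma = Z^-1(gamma0), parametrised by the r lifts of each arc of gamma0,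
   with the pulled-back orientation. *)
Definition lifted_contour (r : nat) (g0 : contour R C)
    (lift : contour_arc g0 -> 'I_r -> R -> M) : contour R M :=
  @Contour R M (contour_arc g0 * 'I_r)%type
    (fun aj => arc_span aj.1) (fun aj => lift aj.1 aj.2).

Definition contour_lift (Z : M -> sphere) (r : nat) (g0 : contour R C)
    (lift : contour_arc g0 -> 'I_r -> R -> M) : Prop :=
  forall a : contour_arc g0,
    [/\ forall j, {within [set` arc_span a], continuous (lift a j)},
        forall t, t \in arc_span a ->
          enumerates_fibre Z (arc_path a t) (fun j => lift a j t) &
        exists E : seq R, forall t, interior [set` arc_span a] t ->
          t \notin E -> forall i j, dom i (lift a j t) ->
          smooth_at (coord i \o lift a j) t].

(* Functions on a contour are given by functions on M, of which only the
   restriction to the contour is used. *)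
Definition smooth_along (g : contour R M) (Y : M -> C) : Prop :=
  forall a : contour_arc g,
    {within [set` arc_span a], continuous (Y \o arc_path a)} /\
    exists E : seq R, forall t, interior [set` arc_span a] t ->
      t \notin E -> smooth_at (Y \o arc_path a) t.

(* Pull-back along a curve of the differential equal to (omega i) dx_i in the
   chart i. *)
Definition pullback (omega : bundle_section) (c : R -> M) : R -> C :=
  fun t => let i := chart_at (c t) in
    omega i (c t) * velocity (coord i \o c) t.

Definition surface_integrable (g : contour R M) (omega : bundle_section) : Prop :=
  forall a : contour_arc g, cintegrable [set` arc_span a] (pullback omega (arc_path a)).

Definition surface_integral (g : contour R M) (omega : bundle_section) : C :=
  \sum_(a : contour_arc g) cintegral [set` arc_span a] (pullback omega (arc_path a)).

Definition pairing_form (Y : M -> C) (phi phiv : bundle_section) :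
    bundle_section := fun i p => Y p * phi i p * phiv i p.

Definition pairing (g : contour R M) (Y : M -> C) (phi phiv : bundle_section) : C :=
  surface_integral g (pairing_form Y phi phiv).

Definition gram_det (g : contour R M) (Y : M -> C)
    (chi chiv : nat -> bundle_section) (n : nat) : C :=
  \det (\matrix_(a < n, b < n) pairing g Y (chi a) (chiv b)).

Definition divisor_flag (r : nat) (Xi : divisor) (D : nat -> divisor) : Prop :=
  [/\ forall n p, 0 <= D n p <= D n.+1 p,
      forall n, div_degree (D n) = n%:Z &
      exists Rem : 'I_r -> divisor,
        (forall l p, 0 <= Rem l p <= Xi p) /\
        (forall l, div_degree (Rem l) = l%:Z) /\
        (forall (k : nat) (l : 'I_r) p, D (k * r + l)%N p = k%:Z * Xi p + Rem l p)].

(* phi in V pairs to zero with every element of V'; for V = P_n and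
   V' = P_{n-1}^vee (and symmetrically). *)
Definition left_biorthogonal (g : contour R M) (Y : M -> C)
    (V V' : set bundle_section) (psi : bundle_section) : Prop :=
  [/\ V psi, ~ sec_eq psi sec0 &
      forall phiv, V' phiv -> pairing g Y psi phiv = 0].

Definition right_biorthogonal (g : contour R M) (Y : M -> C)
    (V V' : set bundle_section) (psiv : bundle_section) : Prop :=
  [/\ V psiv, ~ sec_eq psiv sec0 &
      forall phi, V' phi -> pairing g Y phi psiv = 0].

(* Value of a section at p in the frame of the chart [chart_at p].  The same
   chart is used for a bundle and for its dual, and for sqrt K, so that
   products such as W below do not depend on it. *)
Definition frame_value (phi : bundle_section) (p : M) : C := phi (chart_at p) p.

(* dz / dx in that chart, for z = Z. *)
Definition frame_dZ (Z : M -> sphere) (p : M) : C :=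
  derive1 (finite_part Z \o param (chart_at p)) (coord (chart_at p) p).

Section Matrices.
Variables (r : nat) (sheet : C -> 'I_r -> M).

Definition Phi_mx (phi : 'I_r -> bundle_section) (z : C) : 'M[C]_r :=
  \matrix_(a, b) frame_value (phi a) (sheet z b).
Definition Phiv_mx (phiv : 'I_r -> bundle_section) (z : C) : 'M[C]_r :=
  \matrix_(a, b) frame_value (phiv b) (sheet z a).
Definition Psi_mx (psi : nat -> bundle_section) (k : nat) (z : C) : 'M[C]_r :=
  \matrix_(a < r, b < r) frame_value (psi (k * r + a)%N) (sheet z b).
Definition Psiv_mx (psiv : nat -> bundle_section) (k : nat) (z : C) : 'M[C]_r :=
  \matrix_(a < r, b < r) frame_value (psiv (k * r + b)%N) (sheet z a).

Definition Lambda_mx (Y : M -> C) (z : C) : 'M[C]_r :=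
  diag_mx (\row_j Y (sheet z j)).

(* The j-th sheet contributes (phi_a Y phiv_b)_i dx_i = (...)_i (dz/dx_i)^-1 dz. *)
Definition weight_mx (Z : M -> sphere) (Y : M -> C)
    (phi phiv : 'I_r -> bundle_section) (z : C) : 'M[C]_r :=
  Phi_mx phi z *m Lambda_mx Y z *m
  diag_mx (\row_j (frame_dZ Z (sheet z j))^-1) *m Phiv_mx phiv z.

End Matrices.

End Surface.

Section WeightIntegral.
Variables (R : realType) (r : nat).
Local Notation C := (Cplx R).
Variables (g0 : contour R C) (W : C -> 'M[C]_r).

Definition weight_integrand (P Pv : 'M[{poly C}]_r) (z : C) : 'M[C]_r :=
  mxpoly_eval P z *m W z *m mxpoly_eval Pv z.

Definition weight_integrable (P Pv : 'M[{poly C}]_r) : Prop :=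
  forall a b, plane_integrable g0 (fun z => weight_integrand P Pv z a b).

Definition weight_integral (P Pv : 'M[{poly C}]_r) : 'M[C]_r :=
  \matrix_(a, b) plane_integral g0 (fun z => weight_integrand P Pv z a b).

End WeightIntegral.

(* Main.v *)
Require Import Defs.
From HB Require Import structures.
From mathcomp Require Import all_boot all_order all_algebra.
From mathcomp Require Import finmap complex.
From mathcomp Require Import all_classical all_reals all_analysis.
From mathcomp Require Import measurable_realfun.
Set Implicit Arguments.
Unset Strict Implicit.
Unset Printing Implicit Defensive.
Import Order.TTheory GRing.Theory Num.Theory numFieldNormedType.Exports.
Local Open Scope ring_scope.
Local Open Scope classical_set_scope.

(** The integral of a differential over [gamma = Z^-1(gamma0)] is the integral
    over [gamma0] of its trace, the sum over the sheets of the differential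
    divided by [dZ] ([integral_trace]): on the plane arc and on each of its lifts
    the velocities differ by the factor [dZ], and two enumerations of the same
    fibre agree up to a permutation.  At each point of the plane,
    [P_k W Pv_l = Psi_k Lambda (dZ)^-1 Psiv_l], whose entry [(a, b)] is the
    trace of [Y psi_(kr+a) psiv_(lr+b)].  The matrix of integrals is therefore
    the matrix of pairings [<psi_(kr+a), psiv_(lr+b)>]
    ([weight_integral_pairing]), and the orthogonality of the matrix polynomials
    is that of the sections.

    Nonvanishing of the Gram determinants makes the pairing nondegenerate between
    the sections of the two bundles with poles at most [D_n]
    ([flag_nondegenerate]).  Hence a nonzero section of the step [n + 1] that is
    orthogonal to the step [n] is not in the step [n], so it spans the quotient
    ([biorthogonal_spans]), and the norms [h_n] do not vanish
    ([biorthogonal_norm_neq0]).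

    For the leading coefficient [F] of [P_k], suppose that [v F = 0] for a row
    [v].  Then [v P_k] has degree less than [k], so the section
    [sum_a v_a psi_(kr+a)] is a combination of sections with poles at most [Xi],
    with coefficients polynomials of degree less than [k] in [Z]; its poles are
    at most [k Xi = D_(kr)] ([polynomial_combination_H0]).  It is thus orthogonal
    to [psiv_(kr+b)], which gives [v_b h_(kr+b) = 0] and [v = 0]
    ([leading_coef_unit]).  The dual statement follows by exchanging the two
    bundles and transposing. *)

(** * Orders of vanishing in one variable *)

Section Orders.
Variable K : numFieldType.
Implicit Types (f h : K -> K) (w : K) (m : int).

Lemma holomorphic_at_continuous f w :
  holomorphic_at f w -> {for w, continuous f}.
Proof.
move=> /nbhs_singleton df; apply: differentiable_continuous.
exact/derivable1_diffP.
Qed.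

Lemma holomorphic_at_cst (c : K) w : holomorphic_at (fun=> c) w.
Proof. by apply: (@nearW _ (nbhs w)) => z; exact: derivable_cst. Qed.

Lemma holomorphic_atD f h w : holomorphic_at f w -> holomorphic_at h w ->
  holomorphic_at (fun z => f z + h z) w.
Proof.
move=> hf hh; apply: (@filterS2 _ (nbhs w) _ _ _ _ _ hf hh) => z.
exact: derivableD.
Qed.

Lemma holomorphic_atM f h w : holomorphic_at f w -> holomorphic_at h w ->
  holomorphic_at (fun z => f z * h z) w.
Proof.
move=> hf hh; apply: (@filterS2 _ (nbhs w) _ _ _ _ _ hf hh) => z.
exact: derivableM.
Qed.

Lemma holomorphic_at_subX w n : holomorphic_at (fun z => (z - w) ^+ n) w.
Proof.
elim: n => [|n ih].
  by under eq_fun do rewrite expr0; exact: holomorphic_at_cst.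
under eq_fun do rewrite exprS; apply: holomorphic_atM => //.
apply: holomorphic_atD; last exact: holomorphic_at_cst.
by apply: (@nearW _ (nbhs w)) => z; exact: derivable_id.
Qed.

Lemma continuous_eq_dnbhs f h w : {for w, continuous f} ->
  {for w, continuous h} -> (\forall z \near w^', f z = h z) -> f w = h w.
Proof.
move=> cf ch fh.
have cf' : f @ w^' --> f w.
  by apply: cvg_trans cf; apply: cvg_app; exact: nbhs_dnbhs.
have ch' : h @ w^' --> h w.
  by apply: cvg_trans ch; apply: cvg_app; exact: nbhs_dnbhs.
apply: (@cvg_unique _ (@norm_hausdorff K K) (f @ w^')) => //.
apply: cvg_trans ch'; apply: near_eq_cvg.
by apply: filterS fh => z.
Qed.

Lemma order_ge_near f h w m : (\forall z \near w^', f z = h z) ->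
  order_ge f w m -> order_ge h w m.
Proof.
move=> fh [k [hk fk]]; exists k; split => //.
by apply: filterS2 fh fk => z <-.
Qed.

Lemma order_ge_cst (c : K) w : order_ge (fun=> c) w 0.
Proof.
exists (fun=> c); split; first exact: holomorphic_at_cst.
by apply: (@nearW _ w^') => z; rewrite expr0z mul1r.
Qed.

Lemma order_ge0 w m : order_ge (fun=> 0) w m.
Proof.
exists (fun=> 0); split; first exact: holomorphic_at_cst.
by apply: (@nearW _ w^') => z; rewrite mulr0.
Qed.

Lemma order_geD f h w m : order_ge f w m -> order_ge h w m ->
  order_ge (fun z => f z + h z) w m.
Proof.
move=> [k [hk fk]] [l [hl hhl]]; exists (fun z => k z + l z); split.
  exact: holomorphic_atD.
by apply: filterS2 fk hhl => z -> ->; rewrite mulrDr.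
Qed.

Lemma order_geM f h w m m' : order_ge f w m -> order_ge h w m' ->
  order_ge (fun z => f z * h z) w (m + m').
Proof.
move=> [k [hk fk]] [l [hl hhl]]; exists (fun z => k z * l z); split.
  exact: holomorphic_atM.
apply: filterS3 (nbhs_dnbhs_neq w) fk hhl => z; rewrite -subr_eq0 => zw -> ->.
by rewrite expfzDr// mulrACA.
Qed.

Lemma order_geZ (c : K) f w m :
  order_ge f w m -> order_ge (fun z => c * f z) w m.
Proof.
by move=> hf; rewrite -[m]add0r; apply: order_geM => //; exact: order_ge_cst.
Qed.

Lemma order_ge_sum n (f : 'I_n -> K -> K) w m :
  (forall a, order_ge (f a) w m) -> order_ge (fun z => \sum_(a < n) f a z) w m.
Proof.
elim: n f => [|n ih] f hf.
  by under eq_fun do rewrite big_ord0; exact: order_ge0.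
under eq_fun do rewrite big_ord_recl.
by apply: order_geD => //; apply: ih => a; exact: hf.
Qed.

Lemma order_ge_le f w m m' : m' <= m -> order_ge f w m -> order_ge f w m'.
Proof.
move=> mm' [k [hk fk]]; have [n mE] : exists n : nat, m = m' + n%:Z.
  by exists `|m - m'|%N; rewrite gez0_abs ?subr_ge0// [RHS]addrC subrK.
exists (fun z => (z - w) ^+ n * k z); split.
  by apply: holomorphic_atM => //; exact: holomorphic_at_subX.
apply: filterS2 (nbhs_dnbhs_neq w) fk => z; rewrite -subr_eq0 => zw ->.
by rewrite mulrA [_ ^+ n]exprnP -expfzDr// -mE.
Qed.

Lemma order_eq_ge f w m : order_eq f w m -> order_ge f w m.
Proof. by move=> [h [hh _ fh]]; exists h. Qed.

Lemma order_eq_inj f w m m' : order_eq f w m -> order_eq f w m' -> m = m'.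
Proof.
wlog mm' : m m' / m < m'.
  move=> wl hm hm'; have [|m'm|//] := ltgtP m m'; first by move/wl; exact.
  by apply/esym; exact: wl m'm hm' hm.
move=> [h [hh h0 fh]] [h' [hh' h'0 fh']]; exfalso.
have [n mE] : exists n : nat, m' = m + n.+1%:Z.
  exists (`|m' - m|.-1)%N; rewrite prednK ?absz_gt0 ?subr_eq0 ?gt_eqF//.
  by rewrite gez0_abs ?subr_ge0 ?ltW// [RHS]addrC subrK.
suff : h w = (w - w) ^+ n.+1 * h' w.
  by rewrite subrr expr0n mul0r => /eqP; rewrite (negPf h0).
apply: (@continuous_eq_dnbhs h (fun z => (z - w) ^+ n.+1 * h' z)).
- exact: holomorphic_at_continuous.
- apply: holomorphic_at_continuous; apply: holomorphic_atM => //.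
  exact: holomorphic_at_subX.
apply: filterS3 (nbhs_dnbhs_neq w) fh fh' => z; rewrite -subr_eq0 => zw fz fz'.
apply: (mulfI (expfz_neq0 m zw)).
by rewrite mulrA [_ ^+ n.+1]exprnP -expfzDr// -mE -fz -fz'.
Qed.

(** A polynomial of degree at most k in a function with a pole of order at most
    m has a pole of order at most k m. *)
Lemma order_ge_horner (q : {poly K}) k f w m : 0 <= m -> (size q <= k.+1)%N ->
  order_ge f w (- m) -> order_ge (fun z => q.[f z]) w (- (k%:Z * m)).
Proof.
move=> m0 qk hf; under eq_fun do rewrite (horner_coef_wide _ qk).
apply: order_ge_sum => i; apply: order_geZ.
have : order_ge (fun z => f z ^+ i) w (- (i%:Z * m)).
  elim: (i : nat) => [|n ih].
    by rewrite mul0r oppr0; under eq_fun do rewrite expr0; exact: order_ge_cst.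
  under eq_fun do rewrite exprS.
  by rewrite intS mulrDl mul1r opprD; exact: order_geM.
by apply: order_ge_le; rewrite lerN2 ler_wpM2r// lez_nat -ltnS.
Qed.

End Orders.

(** * Complex-valued functions of a real variable *)

Lemma derivable1_cvg (K : numFieldType) (V : normedModType K) (f : K -> V)
    (a : K) : derivable f a 1 ->
  h^-1 *: (f (h + a) - f a) @[h --> 0^'] --> derive1 f a.
Proof.
rewrite derive1E /derivable /derive.
suff -> : (fun h : K => h^-1 *: ((f \o shift a) (h *: 1) - f a)) =
          (fun h => h^-1 *: (f (h + a) - f a)) by [].
by apply/funext => h /=; rewrite [h *: 1]mulr1.
Qed.

Lemma cvg_near_eq T (U : topologicalType) (F : set_system T) {FF : Filter F}
    (f g : T -> U) (l : U) :
  f @ F --> l -> (\forall t \near F, f t = g t) -> g @ F --> l.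
Proof.
move=> fl fg; apply: cvg_trans fl; apply: near_eq_cvg.
by apply: filterS fg.
Qed.

Section ComplexValued.
Variable R : realType.
Local Notation C := (Cplx R).
Implicit Types (f c g : R -> C) (t : R) (A : set R).

Lemma ReD (x y : C) : complex.Re (x + y) = complex.Re x + complex.Re y.
Proof. by case: x => ? ?; case: y. Qed.

Lemma ImD (x y : C) : complex.Im (x + y) = complex.Im x + complex.Im y.
Proof. by case: x => ? ?; case: y. Qed.

Lemma ReB (x y : C) : complex.Re (x - y) = complex.Re x - complex.Re y.
Proof. by case: x => ? ?; case: y. Qed.

Lemma ImB (x y : C) : complex.Im (x - y) = complex.Im x - complex.Im y.
Proof. by case: x => ? ?; case: y. Qed.

Lemma ReM (x y : C) : complex.Re (x * y) =
  complex.Re x * complex.Re y - complex.Im x * complex.Im y.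
Proof. by case: x => ? ?; case: y. Qed.

Lemma ImM (x y : C) : complex.Im (x * y) =
  complex.Re x * complex.Im y + complex.Im x * complex.Re y.
Proof. by case: x => ? ?; case: y. Qed.

Lemma complex_normE (x : C) : `|x| =
  ((Num.sqrt (complex.Re x ^+ 2 + complex.Im x ^+ 2))%:C)%C :> R[i].
Proof. exact: (normc_def (x : R[i])). Qed.

Lemma ltc_Re (x : C) (e : R) : (x : R[i]) < (e%:C)%C -> complex.Re x < e.
Proof. by rewrite ltcE => /andP[]. Qed.

Lemma Re_cvg T (F : set_system T) {FF : Filter F} (f : T -> C) (z : C) :
  f @ F --> z -> complex.Re (f t) @[t --> F] --> complex.Re z.
Proof.
move=> /cvgrPdist_lt fz; apply/cvgrPdist_lt => e e0.
have /fz : (0 : C) < ((e%:C)%C : R[i]) by rewrite ltcE /= eqxx.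
apply: filterS => t; rewrite complex_normE => /ltc_Re /=.
rewrite -ReB; apply: le_lt_trans.
by rewrite -sqrtr_sqr ler_wsqrtr// lerDl sqr_ge0.
Qed.

Lemma Im_cvg T (F : set_system T) {FF : Filter F} (f : T -> C) (z : C) :
  f @ F --> z -> complex.Im (f t) @[t --> F] --> complex.Im z.
Proof.
move=> /cvgrPdist_lt fz; apply/cvgrPdist_lt => e e0.
have /fz : (0 : C) < ((e%:C)%C : R[i]) by rewrite ltcE /= eqxx.
apply: filterS => t; rewrite complex_normE => /ltc_Re /=.
rewrite -ImB; apply: le_lt_trans.
by rewrite -sqrtr_sqr ler_wsqrtr// lerDr sqr_ge0.
Qed.

Lemma complex_cvg T (F : set_system T) {FF : Filter F} (f : T -> C) (z : C) :
  complex.Re (f t) @[t --> F] --> complex.Re z ->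
  complex.Im (f t) @[t --> F] --> complex.Im z -> f @ F --> z.
Proof.
move=> /cvgrPdist_lt fR /cvgrPdist_lt fI; apply/cvgrPdist_lt => e.
rewrite ltcE /= => /andP[/eqP e0 e1].
have e2 : 0 < complex.Re e / 2 by rewrite divr_gt0.
apply: filterS2 (fR _ e2) (fI _ e2) => t.
rewrite complex_normE ltcE /= e0 eqxx /= -ReB -ImB.
set a := complex.Re _; set b := complex.Im _ => ha hb.
rewrite -[complex.Re e]ger0_norm ?(ltW e1)// -sqrtr_sqr.
rewrite ltr_sqrt ?exprn_gt0//.
rewrite -[a ^+ 2]real_normK ?num_real// -[b ^+ 2]real_normK ?num_real//.
rewrite (splitr (complex.Re e)) sqrrD.
apply: (@lt_le_trans _ _ ((complex.Re e / 2) ^+ 2 + (complex.Re e / 2) ^+ 2)).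
  by apply: ltrD; rewrite ltr_pXn2r// ?nnegrE ?normr_ge0// ltW.
by rewrite [leRHS]addrAC lerDl mulrn_wge0// mulr_ge0// ltW.
Qed.

Lemma velocity_cvg c t :
  derivable (re_part c) t 1 -> derivable (im_part c) t 1 ->
  ((h^-1)%:C)%C * (c (h + t) - c t) @[h --> (0 : R)^'] --> velocity c t.
Proof.
move=> /derivable1_cvg cR /derivable1_cvg cI; apply: complex_cvg => /=.
  under eq_fun do rewrite ReM ReB /= mul0r subr0; exact: cR.
by under eq_fun do rewrite ImM ImB /= mul0r addr0; exact: cI.
Qed.

Lemma velocity_lim c t (v : C) :
  ((h^-1)%:C)%C * (c (h + t) - c t) @[h --> (0 : R)^'] --> v ->
  velocity c t = v.
Proof.
move=> cv; have cR := @Re_cvg _ _ (dnbhs_filter 0) _ _ cv.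
have cI := @Im_cvg _ _ (dnbhs_filter 0) _ _ cv.
have RE : (fun h : R => complex.Re (((h^-1)%:C)%C * (c (h + t) - c t) : C)) =
    (fun h => h^-1 *: (re_part c (h + t) - re_part c t)).
  by apply/funext => h; rewrite ReM ReB /= mul0r subr0.
have IE : (fun h : R => complex.Im (((h^-1)%:C)%C * (c (h + t) - c t) : C)) =
    (fun h => h^-1 *: (im_part c (h + t) - im_part c t)).
  by apply/funext => h; rewrite ImM ImB /= mul0r addr0.
rewrite RE in cR; rewrite IE in cI.
rewrite /velocity /derive1 (cvg_lim (@norm_hausdorff R R) cR).
by rewrite (cvg_lim (@norm_hausdorff R R) cI); case: (v).
Qed.

Lemma real_cvg0 : ((h%:C)%C : C) @[h --> (0 : R)^'] --> (0 : C).
Proof.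
by apply: complex_cvg => /=; [exact: nbhs_dnbhs|exact: cvg_cst].
Qed.

(** The chain rule for a complex-differentiable function along a curve which is
    only differentiable in the real sense. *)
Lemma velocity_comp (F : C -> C) c g t : derivable F (c t) 1 ->
  derivable (re_part c) t 1 -> derivable (im_part c) t 1 ->
  (\forall s \near t, g s = F (c s)) ->
  velocity g t = derive1 F (c t) * velocity c t.
Proof.
move=> /derivable1_cvg dF cR cI gF; apply: velocity_lim.
have cv := velocity_cvg cR cI.
pose d h := c (h + t) - c t.
have d0 : d h @[h --> (0 : R)^'] --> (0 : C).
  have := @cvgM _ _ _ (dnbhs_filter (0 : R)) _ _ _ _ real_cvg0 cv.
  rewrite mul0r => d0.
  apply: (@cvg_near_eq _ _ _ (dnbhs_filter (0 : R)) _ _ _ d0).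
  apply: filterS (nbhs_dnbhs_neq (0 : R)) => h h0.
  by rewrite /d /= mulrA -rmorphM mulfV// mul1r.
(* The difference quotient of F is completed by its limit at 0, because the
   increment d h may vanish for h <> 0. *)
pose q (k : C) :=
  if k == 0 then derive1 F (c t) else k^-1 * (F (k + c t) - F (c t)).
have q0 : q @ (0 : C) --> derive1 F (c t).
  have -> : derive1 F (c t) = q 0 by rewrite /q eqxx.
  apply/(@cvgrPdist_lt _ _ _ _ (nbhs_filter (0 : C))) => e e0.
  have /(@cvgrPdist_lt _ _ _ _ (dnbhs_filter (0 : C)))/(_ e e0) := dF.
  rewrite near_withinE.
  apply: (@filterS _ _ (nbhs_filter (0 : C))) => k; rewrite {2}/q.
  case: eqVneq => [->|k0]; last first.
    by move=> /(_ isT); rewrite /q eqxx.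
  by rewrite /q eqxx subrr normr0.
have qd : q (d h) @[h --> (0 : R)^'] --> derive1 F (c t).
  exact: (@cvg_comp _ _ _ d q _ _ _ d0 q0).
apply: (@cvg_near_eq _ _ _ (dnbhs_filter (0 : R)) _ _ _
  (@cvgM _ _ _ (dnbhs_filter (0 : R)) _ _ _ _ qd cv)).
have gF0 := nbhs_singleton gF.
have gFh : \forall h \near (0 : R)^', g (h + t) = F (c (h + t)).
  have tE : h + t @[h --> (0 : R)^'] --> t.
    rewrite -[X in _ --> X]add0r; apply: cvgD; last exact: cvg_cst.
    exact: nbhs_dnbhs.
  exact: tE gF.
apply: filterS gFh => h ->; rewrite gF0 /q -/(d h).
case: (eqVneq (d h) 0) => [dh0|dh0].
  have cE : c (h + t) = c t by apply/eqP; rewrite -subr_eq0 -/(d h) dh0.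
  by rewrite /= cE !subrr !mulr0.
by rewrite /= -/(d h) mulrC -mulrA (negPf dh0) mulVKf// subrK.
Qed.

Local Notation mu := (@lebesgue_measure R).

Lemma integrable_linear A (u v : R -> R) (a b : R) : measurable A ->
  mu.-integrable A (EFin \o u) -> mu.-integrable A (EFin \o v) ->
  mu.-integrable A (EFin \o (fun t => a * u t + b * v t)) /\
  Rintegral mu A (fun t => a * u t + b * v t) =
    a * Rintegral mu A u + b * Rintegral mu A v.
Proof.
move=> mA iu iv.
have iau : mu.-integrable A (EFin \o (fun t => a * u t)).
  rewrite (_ : EFin \o _ = (fun t => a%:E * (EFin \o u) t)%E).
    exact: integrableZl.
  by apply/funext => t /=; rewrite EFinM.
have ibv : mu.-integrable A (EFin \o (fun t => b * v t)).
  rewrite (_ : EFin \o _ = (fun t => b%:E * (EFin \o v) t)%E).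
    exact: integrableZl.
  by apply/funext => t /=; rewrite EFinM.
split; last by rewrite RintegralD// !RintegralZl.
rewrite (_ : EFin \o _ = ((EFin \o (fun t => (a * u t)%R)) \+
  (EFin \o (fun t => (b * v t)%R)))%E); first exact: integrableD.
by apply/funext => t /=; rewrite EFinD.
Qed.

Lemma cintegral0 A : cintegrable A (fun=> 0 : C) /\ cintegral A (fun=> 0 : C) = 0.
Proof.
have i0 : mu.-integrable A (EFin \o (fun=> 0 : R)) by exact: integrable0.
split; first by split; exact: i0.
have r0 : Rintegral mu A (fun=> 0) = 0 by rewrite /Rintegral integral0.
by rewrite /cintegral /re_part /im_part /= r0.
Qed.

Lemma cintegralD A f g : measurable A -> cintegrable A f -> cintegrable A g ->
  cintegrable A (fun t => f t + g t) /\
  cintegral A (fun t => f t + g t) = cintegral A f + cintegral A g.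
Proof.
move=> mA [fR fI] [gR gI].
have [iR eR] := integrable_linear 1 1 mA fR gR.
have [iI eI] := integrable_linear 1 1 mA fI gI.
have RE : re_part (fun t => f t + g t) =
  (fun t => 1 * re_part f t + 1 * re_part g t).
  by apply/funext => t; rewrite /re_part ReD !mul1r.
have IE : im_part (fun t => f t + g t) =
  (fun t => 1 * im_part f t + 1 * im_part g t).
  by apply/funext => t; rewrite /im_part ImD !mul1r.
split; first by rewrite /cintegrable RE IE.
by rewrite /cintegral RE IE eR eI !mul1r.
Qed.

Lemma cintegralZ A f (k : C) : measurable A -> cintegrable A f ->
  cintegrable A (fun t => k * f t) /\
  cintegral A (fun t => k * f t) = k * cintegral A f.
Proof.
move=> mA [fR fI].
have [iR eR] := integrable_linear (complex.Re k) (- complex.Im k) mA fR fI.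
have [iI eI] := integrable_linear (complex.Re k) (complex.Im k) mA fI fR.
have RE : re_part (fun t => k * f t) =
  (fun t => complex.Re k * re_part f t + - complex.Im k * im_part f t).
  by apply/funext => t; rewrite /re_part ReM mulNr.
have IE : im_part (fun t => k * f t) =
  (fun t => complex.Re k * im_part f t + complex.Im k * re_part f t).
  by apply/funext => t; rewrite /im_part ImM.
split; first by rewrite /cintegrable RE IE.
by rewrite /cintegral RE IE eR eI; case: (k) => a b; rewrite mulNr.
Qed.

Lemma cintegral_sum A I (s : seq I) (F : I -> R -> C) : measurable A ->
  (forall i, cintegrable A (F i)) ->
  cintegrable A (fun t => \sum_(i <- s) F i t) /\
  cintegral A (fun t => \sum_(i <- s) F i t) = \sum_(i <- s) cintegral A (F i).
Proof.
move=> mA iF; elim: s => [|i s [ihi ihe]].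
  under [X in cintegrable _ X]eq_fun do rewrite big_nil.
  under [X in cintegral _ X]eq_fun do rewrite big_nil.
  by rewrite big_nil; exact: cintegral0.
under [X in cintegrable _ X]eq_fun do rewrite big_cons.
under [X in cintegral _ X]eq_fun do rewrite big_cons.
by rewrite big_cons -ihe; exact: cintegralD.
Qed.

Lemma measurable_fun_seq d (U : sigmaRingType d) (E : seq R) A
    (u : measurableTypeR R -> U) :
  measurable_fun (A `&` [set` E] : set (measurableTypeR R)) u.
Proof.
move=> _ B _; apply: countable_measurable => //.
apply: (@sub_countable _ _ _ [set` E]).
  by apply: subset_card_le => t -[[]].
exact/finite_set_countable/finite_seq.
Qed.

Lemma integrable_eq_off_seq A (E : seq R) (u v : R -> R) : measurable A ->
  (forall t, A t -> t \notin E -> u t = v t) ->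
  mu.-integrable A (EFin \o u) ->
  mu.-integrable A (EFin \o v) /\ Rintegral mu A v = Rintegral mu A u.
Proof.
move=> mA uv iu.
have cE : countable [set` E] by exact/finite_set_countable/finite_seq.
have mE : measurable [set` E] by exact: countable_measurable.
have E0 : mu [set` E] = 0%E by exact: countable_lebesgue_measure0.
have mu0 : measurable_fun A u.
  by apply/measurable_EFinP; exact: measurable_int iu.
have uvE : {in A `\` [set` E], EFin \o u =1 EFin \o v}.
  by move=> t /set_mem[At /negP Et] /=; rewrite uv.
have mv : measurable_fun A v.
  rewrite -(setUIDK A [set` E]); apply/measurable_funU.
  - exact: measurableI.
  - exact: measurableD.
  split; first exact: measurable_fun_seq.
  apply: (eq_measurable_fun u) => [t /set_mem[At /negP Et]|]; first exact: uv.
  by apply: measurable_funS mu0.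
have mu1 : measurable_fun A (EFin \o u) by exact/measurable_EFinP.
have mv1 : measurable_fun A (EFin \o v) by exact/measurable_EFinP.
have iv : mu.-integrable A (EFin \o v).
  apply: (@negligible_integrable _ _ _ mu _ _ _ mE mA mv1 E0).2.
  apply: (@eq_integrable _ _ _ mu _ (measurableD mA mE) _ _ uvE).
  exact: (@negligible_integrable _ _ _ mu _ _ _ mE mA mu1 E0).1 iu.
split=> //; rewrite /Rintegral; congr fine.
rewrite (@negligible_integral _ _ _ mu _ _ _ mE mA iv E0).
rewrite (@negligible_integral _ _ _ mu _ _ _ mE mA iu E0).
by apply: eq_integral => t At; rewrite -uvE.
Qed.

(** Integrability and the integral are insensitive to a change of the function
    at finitely many points. *)
Lemma cintegral_eq_off_seq A (E : seq R) f g : measurable A ->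
  (forall t, A t -> t \notin E -> f t = g t) -> cintegrable A f ->
  cintegrable A g /\ cintegral A g = cintegral A f.
Proof.
move=> mA fg [fR fI].
have [iR eR] := @integrable_eq_off_seq A E (re_part f) (re_part g) mA
  (fun t At Et => congr1 (@complex.Re R) (fg t At Et)) fR.
have [iI eI] := @integrable_eq_off_seq A E (im_part f) (im_part g) mA
  (fun t At Et => congr1 (@complex.Im R) (fg t At Et)) fI.
by split => //; rewrite /cintegral eR eI.
Qed.

Lemma eq_cintegral A f g : (forall t, A t -> f t = g t) ->
  cintegral A f = cintegral A g.
Proof.
move=> fg; rewrite /cintegral.
congr (_ +i* _)%C; apply: eq_Rintegral => t /set_mem At;
by rewrite /re_part /im_part fg.
Qed.

Lemma itv_interior_seq (i : interval R) : exists E : seq R,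
  forall t, [set` i] t -> t \notin E -> interior [set` i] t.
Proof.
case: i => [[b x|b] [b' y|b']].
- exists [:: x; y] => t; rewrite interior_itv /= !in_itv /= => /andP[xt ty].
  rewrite !inE negb_or => /andP[tx ty'].
  by rewrite !lt_neqAle ty' eq_sym tx (lteifW xt) (lteifW ty).
- exists [:: x] => t; case: b' => /=; first by rewrite in_itv /= andbF.
  rewrite interior_itv /= !in_itv /= !andbT => xt; rewrite inE => tx.
  by rewrite lt_neqAle eq_sym tx (lteifW xt).
- exists [:: y] => t; case: b => /=; last by rewrite in_itv /=.
  rewrite interior_itv /= !in_itv /= => ty; rewrite inE => ty'.
  by rewrite lt_neqAle ty' (lteifW ty).
- exists [::] => t; case: b; case: b' => //=; rewrite ?in_itv //=.
  by rewrite interior_itv_Nyy.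
Qed.

End ComplexValued.

(** * Sections with prescribed poles *)

Section Sections.
Variables (R : realType) (M : topologicalType).
Variable S : compact_riemann_surface R M.
Local Notation C := (Cplx R).
Local Notation dom := (@Defs.dom R M S).
Local Notation coord := (@Defs.coord R M S).
Implicit Types (g : transition S) (D : divisor M) (phi eta : bundle_section S).

(** A local parameter maps a punctured neighbourhood into a punctured
    neighbourhood. *)
Lemma param_dnbhs (i : chart S) (p : M) : dom i p ->
  param i @ (coord i p)^' --> p^'.
Proof.
move=> ip B; rewrite /= => pB.
have pB' : \forall q \near p, q != p -> B q by exact: pB.
have cp := param_continuous ip.
have nc : \forall w \near coord i p, (coord i @` dom i) w.
  by apply: (open_nbhs_nbhs); split; [exact: coord_open|exists p].
change (\forall w \near (coord i p)^', B (param i w)).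
rewrite near_withinE.
have cpB : \forall w \near coord i p, param i w != p -> B (param i w).
  by apply: (cp [set q | q != p -> B q]); rewrite /= (coordK ip); exact: pB'.
apply: (@filterS2 _ _ (nbhs_filter (coord i p)) _ _ _ _ nc cpB).
move=> w [q iq <-] Bq wp.
apply: Bq; apply: contra wp; rewrite (coordK iq) => /eqP ->.
exact: eqxx.
Qed.

Lemma sec_eq_near phi eta (i : chart S) (p : M) : sec_eq phi eta -> dom i p ->
  \forall w \near (coord i p)^', phi i (param i w) = eta i (param i w).
Proof. by move=> pe ip; exact: param_dnbhs (pe i p ip). Qed.

(** Sections that agree generically agree at every point where neither is allowed
    a pole. *)
Lemma sec_eq_point g g' D D' phi eta (i : chart S) (p : M) :
  H0 g D phi -> H0 g' D' eta -> sec_eq phi eta -> dom i p ->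
  D p <= 0 -> D' p <= 0 -> phi i p = eta i p.
Proof.
move=> [_ hphi] [_ heta] pe ip Dp D'p.
have :=
  @continuous_eq_dnbhs _ (phi i \o param i) (eta i \o param i) (coord i p).
rewrite /= (coordK ip); apply.
- by apply: holomorphic_at_continuous; apply: (hphi i p ip).2.
- by apply: holomorphic_at_continuous; apply: (heta i p ip).2.
- exact: sec_eq_near.
Qed.

Lemma sec_eq_refl phi : sec_eq phi phi.
Proof. by move=> i p ip; apply: (@nearW _ p^'). Qed.

Lemma sec_eq_sym phi eta : sec_eq phi eta -> sec_eq eta phi.
Proof. by move=> pe i p ip; apply: filterS (pe i p ip) => q. Qed.

Lemma sec_eq_trans phi eta theta : sec_eq phi eta -> sec_eq eta theta ->
  sec_eq phi theta.
Proof.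
by move=> pe et i p ip; apply: filterS2 (pe i p ip) (et i p ip) => q -> ->.
Qed.

Lemma sec_eqDZ (c : C) phi phi' eta eta' : sec_eq phi phi' -> sec_eq eta eta' ->
  sec_eq (fun i p => c * phi i p + eta i p) (fun i p => c * phi' i p + eta' i p).
Proof.
by move=> pe et i p ip; apply: filterS2 (pe i p ip) (et i p ip) => q -> ->.
Qed.

Lemma H0_DZ g D (c : C) phi eta : H0 g D phi -> H0 g D eta ->
  H0 g D (fun i p => c * phi i p + eta i p).
Proof.
move=> [tphi hphi] [teta heta]; split=> [i j p ip jp|i p ip].
  by rewrite (tphi i j p) // (teta i j p) // mulrDr mulrCA.
have [op hp] := hphi i p ip; have [oe he] := heta i p ip; split.
  by apply: order_geD => //; exact: order_geZ.
move=> Dp; apply: holomorphic_atD (he Dp).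
by apply: holomorphic_atM (hp Dp); exact: holomorphic_at_cst.
Qed.

Lemma H0_sec0 g D : H0 g D (@sec0 R M S).
Proof.
split=> [i j p ip jp|i p ip]; first by rewrite /sec0 mulr0.
by split=> [|_]; [exact: order_ge0|exact: holomorphic_at_cst].
Qed.

Lemma H0_lincomb g D n (c : 'I_n -> C) (phi : 'I_n -> bundle_section S) :
  (forall a, H0 g D (phi a)) -> H0 g D (lincomb c phi).
Proof.
elim: n c phi => [|n ih] c phi hphi.
  rewrite (_ : lincomb c phi = @sec0 R M S); first exact: H0_sec0.
  by apply/funext => i; apply/funext => p; rewrite /lincomb big_ord0.
rewrite (_ : lincomb c phi = fun i p => c ord0 * phi ord0 i p +
    lincomb (c \o lift ord0) (phi \o lift ord0) i p).
  by apply: H0_DZ => //; apply: ih => a; exact: hphi.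
by apply/funext => i; apply/funext => p; rewrite /lincomb big_ord_recl.
Qed.

Lemma H0_sub g D D' : (forall p, D p <= D' p) -> H0 g D `<=` H0 g D'.
Proof.
move=> DD' phi [tphi hphi]; split=> // i p ip; have [op hp] := hphi i p ip.
split=> [|D'p]; last by apply: hp; exact: le_trans (DD' p) D'p.
by apply: order_ge_le op; rewrite lerN2.
Qed.

Lemma effective_degree0 D : (forall p, 0 <= D p) -> div_degree D = 0 ->
  forall p, D p = 0.
Proof.
move=> D0 dD p; apply/eqP; apply/negPn/negP => Dp.
have pD : p \in finsupp D by rewrite mem_finsupp.
move: dD; rewrite /div_degree (big_fsetD1 p) //= => /eqP.
by rewrite paddr_eq0 ?sumr_ge0// (negPf Dp).
Qed.

End Sections.

(** * The pairing on the flag of spaces of sections *)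

Section Pairing.
Variables (R : realType) (M : topologicalType).
Variable S : compact_riemann_surface R M.
Local Notation C := (Cplx R).
Local Notation dom := (@Defs.dom R M S).
Local Notation coord := (@Defs.coord R M S).
Variables (G : contour R M) (Y : M -> C).
Implicit Types (phi eta : bundle_section S).

Lemma pairingC phi eta : pairing G Y phi eta = pairing G Y eta phi.
Proof.
rewrite /pairing; congr surface_integral; apply/funext => i; apply/funext => p.
by rewrite /pairing_form mulrAC.
Qed.

(** Only the values of the sections along the contour matter. *)
Lemma pairing_ext phi phi' eta :
  (forall (a : contour_arc G) t, [set` arc_span a] t ->
     frame_value phi (arc_path a t) = frame_value phi' (arc_path a t)) ->
  pairing G Y phi eta = pairing G Y phi' eta.
Proof.
move=> pp'; apply: eq_bigr => a _; apply: eq_cintegral => t ta.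
by have := pp' a t ta; rewrite /pullback /pairing_form /frame_value => ->.
Qed.

(** The spaces of sections of a bundle g and of its counterpart gv on a flag D of
    divisors which starts at 0 and whose supports avoid the contour, with
    convergent pairings and without nonzero holomorphic sections.  The situation
    is symmetric in g and gv. *)
Record pairing_flag (g gv : transition S) (D : nat -> divisor M) : Prop := {
  flag_mono : forall m n p, (m <= n)%N -> D m p <= D n p;
  flag_zero : forall p, D 0%N p = 0;
  flag_off : forall n (a : contour_arc G) t, [set` arc_span a] t ->
    D n (arc_path a t) <= 0;
  flag_conv : forall n phi eta, H0 g (D n) phi -> H0 gv (D n) eta ->
    surface_integrable G (pairing_form Y phi eta);
  flag_h0 : h0_eq0 g;
  flag_h0v : h0_eq0 gv
}.

Lemma pairing_flagC g gv D : pairing_flag g gv D -> pairing_flag gv g D.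
Proof.
case=> mono zero off conv h0 h0v; split => // n phi eta hphi heta.
rewrite (_ : pairing_form Y phi eta = pairing_form Y eta phi).
  exact: (conv n).
by apply/funext => i; apply/funext => p; rewrite /pairing_form mulrAC.
Qed.

Section Flag.
Variables (g gv : transition S) (D : nat -> divisor M).
Hypothesis hflag : pairing_flag g gv D.

Lemma flag_sub m n phi : (m <= n)%N -> H0 g (D m) phi -> H0 g (D n) phi.
Proof. by move=> mn; apply: H0_sub => p; exact: (flag_mono hflag). Qed.

Lemma pairing_eq n phi phi' eta : H0 g (D n) phi -> H0 g (D n) phi' ->
  sec_eq phi phi' -> pairing G Y phi eta = pairing G Y phi' eta.
Proof.
move=> hphi hphi' pp'; apply: pairing_ext => a t ta.
have D0 := flag_off hflag n ta.
exact: (sec_eq_point hphi hphi' pp' (dom_chart_at S _) D0 D0).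
Qed.

Lemma pairing_lincomb n m (c : 'I_m -> C) (phi : 'I_m -> bundle_section S) eta :
  (forall a, H0 g (D n) (phi a)) -> H0 gv (D n) eta ->
  pairing G Y (lincomb c phi) eta = \sum_(a < m) c a * pairing G Y (phi a) eta.
Proof.
move=> hphi heta; rewrite /pairing /surface_integral.
under [RHS]eq_bigr do rewrite mulr_sumr.
rewrite exchange_big /=; apply: eq_bigr => a _.
have mA : measurable [set` arc_span a] by exact: measurable_itv.
have ic k := cintegralZ (c k) mA (flag_conv hflag (hphi k) heta a).
under [RHS]eq_bigr => k _ do rewrite -(ic k).2.
rewrite -(cintegral_sum _ mA (fun k => (ic k).1)).2.
congr cintegral; apply/funext => t; rewrite /pullback /pairing_form /lincomb.
rewrite mulr_sumr !mulr_suml; apply: eq_bigr => k _.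
by rewrite mulrCA !mulrA [c k * Y _]mulrC.
Qed.

Variables chi chiv : nat -> bundle_section S.
Hypothesis hchi : forall n, spans_mod (chi n) (H0 g (D n.+1)) (H0 g (D n)).
Hypothesis hchiv : forall n, spans_mod (chiv n) (H0 gv (D n.+1)) (H0 gv (D n)).
Hypothesis hdet : forall n, (1 <= n)%N -> gram_det G Y chi chiv n != 0.

Lemma flag_lincomb n phi : H0 g (D n) phi ->
  exists c : 'I_n -> C, sec_eq phi (lincomb c (fun a => chi a)).
Proof.
elim: n phi => [|n ih] phi hphi.
  exists (fun=> 0); apply: sec_eq_trans (flag_h0 hflag (flag_zero hflag) hphi) _.
  by move=> i p ip; apply: (@nearW _ p^') => q; rewrite /lincomb big_ord0.
have [c [eta [heta pE]]] := (hchi n).2 phi hphi; have [d dE] := ih eta heta.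
exists (fun a => oapp d c (unlift ord_max a)).
apply: sec_eq_trans pE _.
apply: sec_eq_trans (sec_eqDZ c (sec_eq_refl (chi n)) dE) _.
move=> i p ip; apply: (@nearW _ p^') => q; rewrite /lincomb big_ord_recr /=.
rewrite unlift_none /= addrC; congr (_ + _); apply: eq_bigr => a _.
suff -> : unlift ord_max (widen_ord (leqnSn n) a) = Some a by [].
rewrite (_ : widen_ord _ a = lift ord_max a) ?liftK//.
by apply/val_inj; rewrite /= /bump leqNgt ltn_ord.
Qed.

(** The pairing is nondegenerate on each step of the flag. *)
Lemma flag_nondegenerate n phi : H0 g (D n) phi ->
  (forall eta, H0 gv (D n) eta -> pairing G Y phi eta = 0) ->
  sec_eq phi (@sec0 R M S).
Proof.
case: n => [|n] hphi; first by move=> _; exact: (flag_h0 hflag (flag_zero hflag)).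
move=> orth; have [c cE] := flag_lincomb hphi.
have hchin (a : 'I_n.+1) : H0 g (D n.+1) (chi a).
  by apply: flag_sub (hchi a).1.
have hchivn (a : 'I_n.+1) : H0 gv (D n.+1) (chiv a).
  apply: H0_sub (hchiv a).1 => p; exact: (flag_mono hflag).
have c0 a : c a = 0.
  pose A := \matrix_(a < n.+1, b < n.+1) pairing G Y (chi a) (chiv b).
  have uA : A \in unitmx by rewrite unitmxE unitfE; exact: hdet.
  suff /(congr1 (mulmxr (invmx A))) : (\row_a c a) *m A = 0.
    by rewrite /= mulmxK// mul0mx => /rowP/(_ a); rewrite !mxE.
  apply/rowP => b; rewrite !mxE; apply: etrans (orth _ (hchivn b)).
  rewrite (pairing_eq _ hphi (H0_lincomb c hchin) cE).
  rewrite (pairing_lincomb c hchin (hchivn b)).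
  by apply: eq_bigr => a' _; rewrite !mxE.
apply: sec_eq_trans cE _ => i p ip; apply: (@nearW _ p^') => q.
by rewrite /lincomb big1// => a _; rewrite c0 mul0r.
Qed.

(** A nonzero section of the step n + 1 orthogonal to the step n spans the
    quotient. *)
Lemma biorthogonal_spans n psi :
  left_biorthogonal G Y (H0 g (D n.+1)) (H0 gv (D n)) psi ->
  spans_mod psi (H0 g (D n.+1)) (H0 g (D n)).
Proof.
move=> [hpsi psi0 orth]; split=> // phi hphi.
have [c [eta [heta psiE]]] := (hchi n).2 psi hpsi.
have [d [theta [htheta phiE]]] := (hchi n).2 phi hphi.
have c0 : c != 0.
  apply/eqP => c0; apply: psi0.
  have psieta : sec_eq psi eta.
    apply: sec_eq_trans psiE _ => i p ip; apply: (@nearW _ p^') => q.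
    by rewrite c0 mul0r add0r.
  apply: (sec_eq_trans psieta); apply: (flag_nondegenerate heta) => zeta hzeta.
  apply: etrans (orth _ hzeta).
  exact: (pairing_eq zeta (flag_sub (leqnSn n) heta) hpsi (sec_eq_sym psieta)).
exists (d / c), (fun i p => - (d / c) * eta i p + theta i p).
split; first exact: (H0_DZ _ heta htheta).
move=> i p ip; apply: filterS2 (psiE i p ip) (phiE i p ip) => q -> ->.
by rewrite mulrDr mulrA divfK// mulNr addrA addrK.
Qed.

End Flag.

Lemma pairing_DZ g gv D n (c : C) phi phi' eta : pairing_flag g gv D ->
  H0 g (D n) phi -> H0 g (D n) phi' -> H0 gv (D n) eta ->
  pairing G Y (fun i p => c * phi i p + phi' i p) eta =
    c * pairing G Y phi eta + pairing G Y phi' eta.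
Proof.
move=> hflag hphi hphi' heta.
pose d (a : 'I_2) : C := if a == ord0 then c else 1.
pose th (a : 'I_2) := if a == ord0 then phi else phi'.
rewrite (_ : (fun i p => _) = lincomb d th).
  have hth a : H0 g (D n) (th a) by rewrite /th; case: ifP.
  rewrite (pairing_lincomb hflag d hth heta) !big_ord_recl big_ord0 addr0.
  by rewrite /d /th /= mul1r.
apply/funext => i; apply/funext => p.
by rewrite /lincomb !big_ord_recl big_ord0 addr0 /d /th /= mul1r.
Qed.

(** The norm of a biorthogonal pair does not vanish. *)
Lemma biorthogonal_norm_neq0 g gv D chi chiv n psi psiv : pairing_flag g gv D ->
  (forall n, spans_mod (chi n) (H0 g (D n.+1)) (H0 g (D n))) ->
  (forall n, spans_mod (chiv n) (H0 gv (D n.+1)) (H0 gv (D n))) ->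
  (forall n, (1 <= n)%N -> gram_det G Y chi chiv n != 0) ->
  left_biorthogonal G Y (H0 g (D n.+1)) (H0 gv (D n)) psi ->
  spans_mod psiv (H0 gv (D n.+1)) (H0 gv (D n)) ->
  pairing G Y psi psiv != 0.
Proof.
move=> hflag hchi hchiv hdet [hpsi psi0 orth] [hpsiv spanv].
apply/eqP => h0; apply: psi0.
apply: (flag_nondegenerate hflag hchi hchiv hdet hpsi) => eta heta.
have [c [theta [htheta etaE]]] := spanv eta heta.
have htheta' := flag_sub (pairing_flagC hflag) (leqnSn n) htheta.
rewrite pairingC.
rewrite (pairing_eq (pairing_flagC hflag) _ heta (H0_DZ c hpsiv htheta') etaE).
rewrite (pairing_DZ c (pairing_flagC hflag) hpsiv htheta' hpsi).
by rewrite ![pairing G Y _ psi]pairingC h0 (orth _ htheta) mulr0 addr0.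
Qed.

End Pairing.

(** * Fibres of Z and push-forward of differentials *)

Section Fibres.
Variables (R : realType) (M : topologicalType).
Variable S : compact_riemann_surface R M.
Local Notation C := (Cplx R).
Local Notation dom := (@Defs.dom R M S).
Local Notation coord := (@Defs.coord R M S).
Variables (Z : M -> sphere R) (Xi : divisor M).
Hypothesis hZ : meromorphic_function S Z Xi.

Lemma polar0 (p : M) (z : C) : Z p = Some z -> Xi p = 0.
Proof.
move=> Zp; apply/eqP; rewrite eq_le (polar_ge0 hZ p) andbT leNgt; apply/negP.
by move/(polar_support hZ p); rewrite Zp.
Qed.

Variable r : nat.
Implicit Types (x y : 'I_r -> M) (z : C).

(** An enumeration meets every point of the fibre: the multiplicity 0 would mean
    that Z - z does not vanish. *)
Lemma enumerates_fibre_ex z x (p : M) :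
  enumerates_fibre S Z z x -> Z p = Some z -> exists j, x j = p.
Proof.
move=> [_ hx] Zp; have ip := @dom_chart_at R M S p; set i := chart_at S p in ip.
have [/existsP[j /eqP xj]|] := boolP [exists j, x j == p]; first by exists j.
rewrite negb_exists => /forallP xp; exfalso.
have := hx i p ip Zp; rewrite (_ : #|_| = 0%N); last first.
  by apply: eq_card0 => j; rewrite inE; apply/negbTE/xp.
move=> [h [hh h0 fh]]; suff h0' : h (coord i p) = 0 by rewrite h0' eqxx in h0.
have hol : holomorphic_at (finite_part Z \o param i) (coord i p).
  by apply: (meromorphic_regular hZ) => //; rewrite Zp.
pose f w := finite_part Z (param i w) + - z.
have -> : h (coord i p) = f (coord i p).
  apply/esym; apply: (@continuous_eq_dnbhs _ f h).
  - exact: (holomorphic_at_continuous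
      (holomorphic_atD hol (holomorphic_at_cst (- z) (coord i p)))).
  - exact: holomorphic_at_continuous.
  - by apply: filterS fh => w; rewrite expr0z mul1r.
by rewrite /f (coordK ip) /finite_part Zp /= subrr.
Qed.

(** Two enumerations of the same fibre agree up to a permutation, multiplicities
    included. *)
Lemma enumerates_fibre_sum z x y (V : nmodType) (F : M -> V) :
  enumerates_fibre S Z z x -> enumerates_fibre S Z z y ->
  \sum_j F (x j) = \sum_j F (y j).
Proof.
move=> [xz hx] [yz hy].
have countE (u : 'I_r -> M) p :
    count_mem p [seq u j | j <- index_enum 'I_r] = #|[pred j | u j == p]|.
  by rewrite count_map -sum1_count -sum1_card.
rewrite -[LHS](big_map x xpredT F) -[RHS](big_map y xpredT F).
apply: perm_big; apply/allP => p _ /=; rewrite !countE.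
have card0 (u : 'I_r -> M) : (forall j, Z (u j) = Some z) -> Z p <> Some z ->
    #|[pred j | u j == p]| = 0%N.
  move=> uz Zp; apply: eq_card0 => j; rewrite inE; apply/negP => /eqP ujp.
  by apply: Zp; rewrite -ujp.
have [Zp|Zp] := pselect (Z p = Some z); last by rewrite !card0.
have ip := @dom_chart_at R M S p.
by have /eqP := order_eq_inj (hx _ p ip Zp) (hy _ p ip Zp).
Qed.

Variables (g0 : contour R C) (lift : contour_arc g0 -> 'I_r -> R -> M).
Hypothesis hg0 : piecewise_smooth_contour g0.
Hypothesis hlift : contour_lift S Z lift.

Lemma lift_near (a : contour_arc g0) j (i : chart S) t :
  interior [set` arc_span a] t -> dom i (lift a j t) ->
  \forall s \near t,
    arc_path a s = finite_part Z (param i (coord i (lift a j s))).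
Proof.
move=> at_ it; have [cont enum _] := hlift a.
have ct : lift a j @ nbhs t --> lift a j t.
  by rewrite (nbhs_subspace_interior at_); exact: cont.
have id : \forall s \near t, dom i (lift a j s).
  apply: (ct [set p | dom i p]); apply: open_nbhs_nbhs.
  by split=> //; exact: dom_open.
apply: filterS2 at_ id => s sa si; rewrite (coordK si).
by rewrite /finite_part ((enum s sa).1 j).
Qed.

(** Away from finitely many parameters, the coordinate change z = Z(p) relates
    the velocities of an arc and of its lifts, and none of the lifts meets a
    branch point. *)
Lemma lift_velocity (a : contour_arc g0) : exists E : seq R,
  forall t, [set` arc_span a] t -> t \notin E ->
  forall j, let i := chart_at S (lift a j t) in
    frame_dZ S Z (lift a j t) != 0 /\
    velocity (arc_path a) t =
      frame_dZ S Z (lift a j t) * velocity (coord i \o lift a j) t.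
Proof.
have [E1 hE1] := itv_interior_seq (arc_span a).
have [_ [E2 hE2]] := hg0 a; have [_ enum [E3 hE3]] := hlift a.
exists (E1 ++ E2 ++ E3) => t ta; rewrite !mem_cat !negb_or => /and3P[t1 t2 t3].
move=> j i; have tint := hE1 t ta t1.
have [_ v0] := hE2 t tint t2; have ip := @dom_chart_at R M S (lift a j t).
have /(_ 0%N) [dR dI] := hE3 t tint t3 i j ip.
have Zt := (enum t ta).1 j.
(* dZ vanishes at no lift, because the plane arc has a nonzero velocity. *)
suff vE : velocity (arc_path a) t =
      frame_dZ S Z (lift a j t) * velocity (coord i \o lift a j) t.
  by split=> //; apply: contra v0 => /eqP d0; rewrite vE d0 mul0r.
apply: (@velocity_comp _ (finite_part Z \o param i) (coord i \o lift a j)) => //.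
  have : holomorphic_at (finite_part Z \o param i) (coord i (lift a j t)).
    by apply: (meromorphic_regular hZ) => //; rewrite Zt.
  exact: nbhs_singleton.
exact: lift_near.
Qed.

Variables (cut : set C) (sheet : C -> 'I_r -> M).
Hypothesis hsheet : sheet_labelling S Z cut sheet.

(** The integral of a differential over the lifted contour is the integral over
    the plane contour of its trace, the sum over the sheets of omega / dZ. *)
Lemma integral_trace (omega : bundle_section S) (F : C -> C) :
  (forall z, F z = \sum_j omega (chart_at S (sheet z j)) (sheet z j) /
                         frame_dZ S Z (sheet z j)) ->
  surface_integrable (lifted_contour lift) omega ->
  plane_integrable g0 F /\
  plane_integral g0 F = surface_integral (lifted_contour lift) omega.
Proof.
move=> hF iomega.
have arcE (a : contour_arc g0) :
    let f t := F (arc_path a t) * velocity (arc_path a) t in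
    cintegrable [set` arc_span a] f /\
    cintegral [set` arc_span a] f =
    \sum_j cintegral [set` arc_span a] (pullback omega (lift a j)).
  move=> f; have mA : measurable [set` arc_span a] by exact: measurable_itv.
  have [iS <-] := cintegral_sum (index_enum 'I_r) mA (fun j => iomega (a, j)).
  have [E hE] := lift_velocity a.
  apply: (cintegral_eq_off_seq (E := E)) iS => // t ta tE.
  have hv := hE t ta tE; have [_ enum _] := hlift a.
  have [_ _ hs _] := hsheet.
  rewrite /f hF (enumerates_fibre_sum
    (fun p => omega (chart_at S p) p / frame_dZ S Z p) (hs _) (enum t ta)).
  rewrite mulr_suml; apply: eq_bigr => j _; have [d0 ->] := hv j.
  by rewrite mulrA divfK.
split=> [a|]; first exact: (arcE a).1.
rewrite /plane_integral /surface_integral.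
rewrite -(pair_bigA _ (fun a j =>
  cintegral [set` arc_span a] (pullback omega (lift a j)))) /=.
by apply: eq_bigr => a _; exact: (arcE a).2.
Qed.

End Fibres.

(** * Leading coefficients *)

Section Leading.
Variables (R : realType) (M : topologicalType).
Variable S : compact_riemann_surface R M.
Local Notation C := (Cplx R).
Local Notation dom := (@Defs.dom R M S).
Local Notation coord := (@Defs.coord R M S).
Variables (Z : M -> sphere R) (Xi : divisor M) (r : nat).
Hypothesis hZ : meromorphic_function S Z Xi.
Variables (cut : set C) (sheet : C -> 'I_r -> M).
Hypothesis hsheet : sheet_labelling S Z cut sheet.
Variable g : transition S.

(** A relation between values of sections on all the sheets holds in every
    chart, away from the poles of Z. *)
Lemma frame_relation D (eta : bundle_section S) (phi : 'I_r -> bundle_section S)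
    (q : 'I_r -> {poly C}) : H0 g D eta -> (forall b, H0 g Xi (phi b)) ->
  (forall z j, frame_value eta (sheet z j) =
     \sum_b (q b).[z] * frame_value (phi b) (sheet z j)) ->
  forall i p z, dom i p -> Z p = Some z ->
    eta i p = \sum_b (q b).[z] * phi b i p.
Proof.
move=> [teta _] hphi rel i p z ip Zp; have [_ _ hs _] := hsheet.
have [j jp] := enumerates_fibre_ex hZ (hs z) Zp.
have cp := dom_chart_at S p.
rewrite (teta i (chart_at S p) p ip cp).
have := rel z j; rewrite jp /frame_value => ->.
rewrite mulr_sumr; apply: eq_bigr => b _.
by rewrite ((hphi b).1 i (chart_at S p) p ip cp) mulrCA.
Qed.

Lemma finite_near_pole (i : chart S) p : dom i p -> Z p = None ->
  \forall w \near (coord i p)^', exists z,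
    [/\ Z (param i w) = Some z & finite_part Z (param i w) = z].
Proof.
move=> ip Zp; have [h [hh h0 fh]] := meromorphic_pole hZ ip Zp.
have ch := holomorphic_at_continuous hh.
have nh : \forall w \near (coord i p)^', h w != 0.
  apply: nbhs_dnbhs.
  exact: (@cvgr_neq0 _ _ _ _ (nbhs_filter (coord i p)) _ _ ch h0).
apply: filterS3 (nbhs_dnbhs_neq (coord i p)) fh nh => w.
rewrite -subr_eq0 => w0.
rewrite /= /finite_part => fw hw.
have : odflt 0 (Z (param i w)) != 0 :> C by rewrite fw mulf_neq0// expfz_neq0.
by case: (Z (param i w)) => [z|] /=; [exists z|rewrite eqxx].
Qed.

(** A combination of sections with poles at most Xi, with coefficients
    polynomials of degree less than k in Z, has poles at most k Xi.  For k = 0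
    the section vanishes off the poles of Z and its irrelevant values there have
    to be reset, whence the section eta'. *)
Lemma polynomial_combination_H0 (D D' : divisor M) k (eta : bundle_section S)
    (phi : 'I_r -> bundle_section S) (q : 'I_r -> {poly C}) :
  (forall p, Xi p = 0 -> D p <= 0) -> (forall p, D' p = k%:Z * Xi p) ->
  H0 g D eta -> (forall b, H0 g Xi (phi b)) ->
  (forall b, (size (q b) <= k)%N) ->
  (forall z j, frame_value eta (sheet z j) =
     \sum_b (q b).[z] * frame_value (phi b) (sheet z j)) ->
  exists eta', H0 g D' eta' /\
    forall i p, dom i p -> Xi p = 0 -> eta' i p = eta i p.
Proof.
move=> DXi D'E heta hphi; case: k D'E => [|k] D'E qk rel.
  exists (@sec0 R M S); split=> [|i p ip Xp]; first exact: H0_sec0.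
  have [z Zp] : exists z, Z p = Some z.
    case Zp: (Z p) => [z|]; first by exists z.
    by have := (polar_support hZ p).1 Zp; rewrite Xp ltxx.
  rewrite (frame_relation heta hphi rel ip Zp) big1// => b _.
  by move: (qk b); rewrite size_poly_leq0 => /eqP ->; rewrite horner0 mul0r.
exists eta; split=> //; split=> [|i p ip]; first exact: heta.1.
have [oeta holeta] := heta.2 i p ip.
case Zp: (Z p) => [z|].
  have Xp := polar0 hZ Zp; have Dp := DXi p Xp; rewrite D'E Xp mulr0 oppr0.
  by split=> [|_]; [apply: order_ge_le oeta; rewrite oppr_ge0|exact: holeta].
have Xp := (polar_support hZ p).1 Zp; split; last first.
  by rewrite D'E pmulr_rle0 ?ltz_nat// leNgt Xp.
have near_eta : \forall w \near (coord i p)^',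
    \sum_b (q b).[finite_part Z (param i w)] * phi b i (param i w) =
    eta i (param i w).
  have nd : \forall w \near (coord i p)^', dom i (param i w).
    apply: (param_dnbhs ip); apply: nbhs_dnbhs; apply: open_nbhs_nbhs.
    by split=> //; exact: dom_open.
  apply: filterS2 nd (finite_near_pole ip Zp) => w iw [z [Zw ->]].
  by rewrite (frame_relation heta hphi rel iw Zw).
apply: (order_ge_near near_eta); rewrite D'E intS mulrDl mul1r opprD addrC.
apply: order_ge_sum => b; apply: order_geM.
  have := order_eq_ge (meromorphic_pole hZ ip Zp).
  exact: order_ge_horner (ltW Xp) (qk b).
exact: ((hphi b).2 i p ip).1.
Qed.

Variables (G : contour R M) (Y : M -> C) (gv : transition S).
Variables (D : nat -> divisor M).
Hypothesis hflag : pairing_flag G Y g gv D.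
Hypothesis D_off : forall n p, Xi p = 0 -> D n p <= 0.
Hypothesis D_mul : forall k p, D (k * r)%N p = k%:Z * Xi p.
Hypothesis G_off : forall (a : contour_arc G) t, [set` arc_span a] t ->
  Xi (arc_path a t) = 0.

(** A linear relation between the rows of the leading coefficient would produce
    a combination of psi_kr, ..., psi_(kr+r-1) in the span of the previous
    sections, and pairing it with psiv_(kr+b) kills its coefficients. *)
Lemma leading_coef_unit (phi : 'I_r -> bundle_section S)
    (psi psiv : nat -> bundle_section S) k (P : 'M[{poly C}]_r) :
  (forall b, H0 g Xi (phi b)) ->
  (forall n, H0 g (D n.+1) (psi n)) -> (forall n, H0 gv (D n.+1) (psiv n)) ->
  (forall n eta, H0 g (D n) eta -> pairing G Y eta (psiv n) = 0) ->
  (forall n m, n != m -> pairing G Y (psi n) (psiv m) = 0) ->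
  (forall n, pairing G Y (psi n) (psiv n) != 0) ->
  mxpoly_deg_le k P ->
  (forall z, Psi_mx sheet psi k z = mxpoly_eval P z *m Phi_mx sheet phi z) ->
  mxpoly_coef k P \in unitmx.
Proof.
move=> hphi hpsi hpsiv orth orthn norm degP relP.
suff inj (v : 'rV_r) : v *m mxpoly_coef k P = 0 -> v = 0.
  rewrite -row_free_unit -kermx_eq0; apply/eqP/row_matrixP => a.
  by rewrite row0; apply: inj; rewrite -row_mul mulmx_ker row0.
move=> vP.
pose eta := lincomb (fun a => v 0 a) (fun a : 'I_r => psi (k * r + a)%N).
have le_kr (a : 'I_r) : (k * r + a < k.+1 * r)%N.
  by rewrite mulSn addnC ltn_add2r.
have hpsik (a : 'I_r) : H0 g (D (k.+1 * r)) (psi (k * r + a)%N).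
  exact: (flag_sub hflag (le_kr a) (hpsi _)).
have heta : H0 g (D (k.+1 * r)) eta by exact: H0_lincomb.
(* q = v P_k loses its coefficient of degree k. *)
pose q b := \sum_a v 0 a *: P a b.
have qk b : (size (q b) <= k)%N.
  apply/leq_sizeP => m; rewrite leq_eqVlt => /predU1P[<-|km].
    have /rowP/(_ b) := vP; rewrite !mxE; apply: etrans.
    by rewrite /q coef_sum; apply: eq_bigr => a _; rewrite coefZ mxE.
  rewrite /q coef_sum big1// => a _; rewrite coefZ.
  by have /leq_sizeP -> := degP a b; rewrite ?mulr0.
have rel z j : frame_value eta (sheet z j) =
    \sum_b (q b).[z] * frame_value (phi b) (sheet z j).
  transitivity ((v *m Psi_mx sheet psi k z) 0 j).
    by rewrite mxE; apply: eq_bigr => a _; rewrite mxE.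
  rewrite relP mulmxA mxE; apply: eq_bigr => b _; rewrite !mxE; congr (_ * _).
  by rewrite horner_sum; apply: eq_bigr => a _; rewrite mxE hornerZ.
have [eta' [heta' etaE]] := polynomial_combination_H0
  (D_off (k.+1 * r)) (D_mul k) heta hphi qk rel.
apply/rowP => b; rewrite mxE.
have hpsivb : H0 gv (D (k.+1 * r)) (psiv (k * r + b)%N).
  exact: (flag_sub (pairing_flagC hflag) (le_kr b) (hpsiv _)).
have : pairing G Y eta (psiv (k * r + b)%N) = 0.
  apply: etrans (orth _ _ (flag_sub hflag (leq_addr b _) heta')).
  apply: pairing_ext => a t ta; rewrite /frame_value; apply/esym.
  by apply: etaE; [exact: dom_chart_at|exact: G_off].
rewrite (pairing_lincomb hflag _ hpsik hpsivb) (bigD1 b)//= big1 => [|a ab].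
  by rewrite addr0 => /eqP; rewrite mulf_eq0 (negPf (norm _)) orbF => /eqP.
by rewrite orthn ?mulr0// eqn_add2l.
Qed.

End Leading.

(** * Matrix polynomials and the matrix weight *)

Section WeightLinear.
Variables (R : realType) (r : nat) (g0 : contour R (Cplx R)).
Local Notation C := (Cplx R).
Implicit Types (P : 'M[{poly C}]_r) (A B : 'M[C]_r) (W : C -> 'M[C]_r).

Lemma mxpoly_eval_constl A P z :
  mxpoly_eval (mxpoly_const A *m P) z = A *m mxpoly_eval P z.
Proof.
apply/matrixP => a b; rewrite !mxE horner_sum; apply: eq_bigr => c _.
by rewrite !mxE hornerM hornerC.
Qed.

Lemma mxpoly_eval_constr A P z :
  mxpoly_eval (P *m mxpoly_const A) z = mxpoly_eval P z *m A.
Proof.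
apply/matrixP => a b; rewrite !mxE horner_sum; apply: eq_bigr => c _.
by rewrite !mxE hornerM hornerC.
Qed.

Lemma mxpoly_monic_constl k P : mxpoly_deg_le k P ->
  mxpoly_coef k P \in unitmx ->
  mxpoly_monic k (mxpoly_const (invmx (mxpoly_coef k P)) *m P).
Proof.
set A := mxpoly_coef k P => degP uA; split=> [a b|].
  rewrite mxE; apply/leq_sizeP => m km; rewrite coef_sum big1// => c _.
  by rewrite mxE coefCM; have /leq_sizeP -> := degP c b; rewrite ?mulr0.
rewrite -(mulVmx uA); apply/matrixP => a b.
rewrite !mxE coef_sum; apply: eq_bigr => c _.
by rewrite [mxpoly_const _ _ _]mxE coefCM [A c b]mxE.
Qed.

Lemma mxpoly_monic_constr k P : mxpoly_deg_le k P ->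
  mxpoly_coef k P \in unitmx ->
  mxpoly_monic k (P *m mxpoly_const (invmx (mxpoly_coef k P))).
Proof.
set A := mxpoly_coef k P => degP uA; split=> [a b|].
  rewrite mxE; apply/leq_sizeP => m km; rewrite coef_sum big1// => c _.
  rewrite [mxpoly_const _ _ _]mxE coefMC.
  by have /leq_sizeP -> := degP a c; rewrite ?mul0r.
rewrite -(mulmxV uA); apply/matrixP => a b.
rewrite !mxE coef_sum; apply: eq_bigr => c _.
by rewrite [mxpoly_const _ _ _]mxE coefMC [A a c]mxE.
Qed.

Lemma plane_integral_sum I (s : seq I) (c : I -> C) (F : I -> C -> C) :
  (forall i, plane_integrable g0 (F i)) ->
  plane_integrable g0 (fun z => \sum_(i <- s) c i * F i z) /\
  plane_integral g0 (fun z => \sum_(i <- s) c i * F i z) =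
    \sum_(i <- s) c i * plane_integral g0 (F i).
Proof.
move=> iF.
have arcE (a : contour_arc g0) :
    let h i t := F i (arc_path a t) * velocity (arc_path a) t in
    let f t := (\sum_(i <- s) c i * F i (arc_path a t)) *
               velocity (arc_path a) t in
    cintegrable [set` arc_span a] f /\
    cintegral [set` arc_span a] f =
      \sum_(i <- s) c i * cintegral [set` arc_span a] (h i).
  move=> h f; have mA : measurable [set` arc_span a] by exact: measurable_itv.
  have ih i := cintegralZ (c i) mA (iF i a).
  have -> : f = fun t => \sum_(i <- s) c i * h i t.
    apply/funext => t; rewrite /f mulr_suml; apply: eq_bigr => i _.
    by rewrite mulrA.
  have [iS ->] := cintegral_sum s mA (fun i => (ih i).1).
  by split=> //; apply: eq_bigr => i _; exact: (ih i).2.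
split=> [a|]; first exact: (arcE a).1.
rewrite /plane_integral; under [RHS]eq_bigr do rewrite mulr_sumr.
by rewrite exchange_big /=; apply: eq_bigr => a _; exact: (arcE a).2.
Qed.

Lemma weight_integral_const W P Pv A B : weight_integrable g0 W P Pv ->
  weight_integrable g0 W (mxpoly_const A *m P) (Pv *m mxpoly_const B) /\
  weight_integral g0 W (mxpoly_const A *m P) (Pv *m mxpoly_const B) =
    A *m weight_integral g0 W P Pv *m B.
Proof.
move=> iW.
pose c a b (ij : 'I_r * 'I_r) := A a ij.2 * B ij.1 b.
pose F (ij : 'I_r * 'I_r) z := weight_integrand W P Pv z ij.2 ij.1.
have entryE a b :
    (fun z =>
       weight_integrand W (mxpoly_const A *m P) (Pv *m mxpoly_const B) z a b) =
    (fun z => \sum_(ij <- index_enum ('I_r * 'I_r)%type) c a b ij * F ij z).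
  apply/funext => z.
  rewrite (_ : weight_integrand _ _ _ _ = A *m weight_integrand W P Pv z *m B).
    rewrite mxE -(pair_bigA _ (fun j i => c a b (j, i) * F (j, i) z)) /=.
    apply: eq_bigr => j _; rewrite mxE mulr_suml; apply: eq_bigr => i _.
    by rewrite /c /F /= mulrAC.
  by rewrite /weight_integrand mxpoly_eval_constl mxpoly_eval_constr !mulmxA.
have lin a b := plane_integral_sum (index_enum ('I_r * 'I_r)%type) (c a b)
  (fun ij => iW ij.2 ij.1 : plane_integrable g0 (F ij)).
split=> [a b|]; first by rewrite entryE; exact: (lin a b).1.
apply/matrixP => a b; rewrite mxE entryE (lin a b).2 mxE.
rewrite -(pair_bigA _ (fun j i =>
  c a b (j, i) * plane_integral g0 (F (j, i)))) /=.
apply: eq_bigr => j _; rewrite mxE mulr_suml; apply: eq_bigr => i _.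
by rewrite /c /F mxE /= mulrAC.
Qed.

End WeightLinear.

Section WeightSections.
Variables (R : realType) (M : topologicalType).
Variable S : compact_riemann_surface R M.
Local Notation C := (Cplx R).
Variables (Z : M -> sphere R) (Xi : divisor M) (r : nat).
Hypothesis hZ : meromorphic_function S Z Xi.
Variables (g0 : contour R C) (lift : contour_arc g0 -> 'I_r -> R -> M).
Hypothesis hg0 : piecewise_smooth_contour g0.
Hypothesis hlift : contour_lift S Z lift.
Variables (cut : set C) (sheet : C -> 'I_r -> M).
Hypothesis hsheet : sheet_labelling S Z cut sheet.
Variable Y : M -> C.

(** The entries of the weighted integral of P and Pv are the pairings of the
    sections that P and Pv represent. *)
Lemma weight_integral_pairing (phi phiv : 'I_r -> bundle_section S)
    (psi psiv : nat -> bundle_section S) k l (P Pv : 'M[{poly C}]_r) :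
  (forall z, Psi_mx sheet psi k z = mxpoly_eval P z *m Phi_mx sheet phi z) ->
  (forall z,
     Psiv_mx sheet psiv l z = Phiv_mx sheet phiv z *m mxpoly_eval Pv z) ->
  (forall a b : 'I_r, surface_integrable (lifted_contour lift)
     (pairing_form Y (psi (k * r + a)%N) (psiv (l * r + b)%N))) ->
  let W := weight_mx sheet Z Y phi phiv in
  weight_integrable g0 W P Pv /\
  weight_integral g0 W P Pv = \matrix_(a < r, b < r)
    pairing (lifted_contour lift) Y (psi (k * r + a)%N) (psiv (l * r + b)%N).
Proof.
move=> relP relPv ipsi W.
have traceE (a b : 'I_r) z : weight_integrand W P Pv z a b =
    \sum_j pairing_form Y (psi (k * r + a)%N) (psiv (l * r + b)%N)
      (chart_at S (sheet z j)) (sheet z j) / frame_dZ S Z (sheet z j).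
  rewrite /weight_integrand /W /weight_mx !mulmxA -relP.
  rewrite -(mulmxA _ (Phiv_mx sheet phiv z)) -relPv.
  rewrite mxE; apply: eq_bigr => j _.
  rewrite /Lambda_mx !mul_mx_diag !mxE /pairing_form /frame_value.
  by rewrite mulrAC [psi _ _ _ * _]mulrC.
have main a b := integral_trace hZ hg0 hlift hsheet (traceE a b) (ipsi a b).
split=> [a b|]; first exact: (main a b).1.
by apply/matrixP => a b; rewrite !mxE; exact: (main a b).2.
Qed.

End WeightSections.

Theorem theorem3p5
  (R : realType) (M : topologicalType) (S : compact_riemann_surface R M)
  (* the square root of K, the character and its flat line bundle *)
  (sqrtK : transition S) (p0 : M) (X : (R -> M) -> Cplx R) (FX : transition S)
  (hsqrtK : canonical_root sqrtK)
  (hsqrtK0 : h0_eq0 sqrtK)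
  (hX : unitary_character p0 X)
  (hFX : flat_bundle p0 X FX)
  (hXK0 : h0_eq0 (tensor_bundle FX sqrtK))
  (hXvK0 : h0_eq0 (tensor_bundle (dual_bundle FX) sqrtK))
  (* the meromorphic function Z of degree r and the flag of divisors D_n *)
  (Z : M -> sphere R) (r : nat) (Xi : divisor M) (D : nat -> divisor M)
  (hr : (0 < r)%N)
  (hZ : meromorphic_function S Z Xi)
  (hdeg : div_degree Xi = r%:Z)
  (hD : divisor_flag r Xi D)
  (* the contours and the weight function *)
  (g0 : contour R (Cplx R)) (lift : contour_arc g0 -> 'I_r -> R -> M)
  (Y : M -> Cplx R)
  (hg0 : piecewise_smooth_contour g0)
  (hlift : contour_lift S Z lift)
  (hY : smooth_along (lifted_contour lift) Y)
  (hconv : forall n phi phiv,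
     H0 (tensor_bundle FX sqrtK) (D n) phi -> H0 (tensor_bundle (dual_bundle FX) sqrtK) (D n) phiv ->
     surface_integrable (lifted_contour lift) (pairing_form Y phi phiv))
  (* chi_n, chi_n^vee and the determinants D_n *)
  (chi chiv : nat -> bundle_section S)
  (hchi : forall n, spans_mod (chi n) (H0 (tensor_bundle FX sqrtK) (D n.+1))
                                      (H0 (tensor_bundle FX sqrtK) (D n)))
  (hchiv : forall n, spans_mod (chiv n) (H0 (tensor_bundle (dual_bundle FX) sqrtK) (D n.+1))
                                        (H0 (tensor_bundle (dual_bundle FX) sqrtK) (D n)))
  (hdet : forall n, (1 <= n)%N -> gram_det (lifted_contour lift) Y chi chiv n != 0)
  (* the biorthogonal sections *)
  (psi psiv : nat -> bundle_section S)
  (hpsi : forall n, left_biorthogonal (lifted_contour lift) Y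
     (H0 (tensor_bundle FX sqrtK) (D n.+1)) (H0 (tensor_bundle (dual_bundle FX) sqrtK) (D n)) (psi n))
  (hpsiv : forall n, right_biorthogonal (lifted_contour lift) Y
     (H0 (tensor_bundle (dual_bundle FX) sqrtK) (D n.+1)) (H0 (tensor_bundle FX sqrtK) (D n)) (psiv n))
  (* the sheets, the bases and the matrix polynomials *)
  (cut : set (Cplx R)) (sheet : Cplx R -> 'I_r -> M)
  (hsheet : sheet_labelling S Z cut sheet)
  (phi phiv : 'I_r -> bundle_section S)
  (hphi : is_basis phi (H0 (tensor_bundle FX sqrtK) Xi))
  (hphiv : is_basis phiv (H0 (tensor_bundle (dual_bundle FX) sqrtK) Xi))
  (P Pv : nat -> 'M[{poly Cplx R}]_r)
  (hPdeg : forall k, mxpoly_deg_le k (P k))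
  (hPvdeg : forall k, mxpoly_deg_le k (Pv k))
  (hP : forall k z,
     Psi_mx sheet psi k z = mxpoly_eval (P k) z *m Phi_mx sheet phi z)
  (hPv : forall k z,
     Psiv_mx sheet psiv k z = Phiv_mx sheet phiv z *m mxpoly_eval (Pv k) z) :
  let h n := pairing (lifted_contour lift) Y (psi n) (psiv n) in
  let W := weight_mx sheet Z Y phi phiv in
  let H (l : nat) : 'M[Cplx R]_r := diag_mx (\row_(a < r) h (l * r + a)%N) in
  let F k := mxpoly_coef k (P k) in
  let Fv k := mxpoly_coef k (Pv k) in
  let Q k := mxpoly_const (invmx (F k)) *m P k in
  let Qv k := Pv k *m mxpoly_const (invmx (Fv k)) in
  let Ht l := invmx (F l) *m H l *m invmx (Fv l) in
  (* the biorthogonal sections span P_n mod P_{n-1}, and dually *)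
  (forall n, spans_mod (psi n) (H0 (tensor_bundle FX sqrtK) (D n.+1))
                               (H0 (tensor_bundle FX sqrtK) (D n)) /\
             spans_mod (psiv n) (H0 (tensor_bundle (dual_bundle FX) sqrtK) (D n.+1))
                                (H0 (tensor_bundle (dual_bundle FX) sqrtK) (D n))) /\
  (* P_k, P_k^vee are biorthogonal for W(z) dz *)
  (forall k l, weight_integrable g0 W (P k) (Pv l) /\
     weight_integral g0 W (P k) (Pv l) = if l == k then H l else 0) /\
  (* the leading coefficients are invertible *)
  (forall k, F k \in unitmx /\ Fv k \in unitmx) /\
  (* the normalised sequences are monic and biorthogonal *)
  (forall k, mxpoly_monic k (Q k) /\ mxpoly_monic k (Qv k)) /\
  (forall k l, weight_integrable g0 W (Q k) (Qv l) /\
     weight_integral g0 W (Q k) (Qv l) = if l == k then Ht l else 0).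
Proof.
move=> h W H F Fv Q Qv Ht.
pose g := tensor_bundle FX sqrtK.
pose gv := tensor_bundle (dual_bundle FX) sqrtK.
pose G := lifted_contour lift.
have [Dmono Ddeg [Rem [RemXi [Remdeg DE]]]] := hD.
have D0 : forall p, D 0%N p = 0.
  apply: effective_degree0; last exact: Ddeg.
  by move=> p; have /andP[] := Dmono 0%N p.
(* The remainder of degree 0 vanishes, so D_(kr) = k Xi. *)
have Rem0 (p : M) : Rem (Ordinal hr) p = 0.
  apply: effective_degree0; last exact: Remdeg.
  by move=> q; have /andP[] := RemXi (Ordinal hr) q.
have Dmul k (p : M) : D (k * r)%N p = k%:Z * Xi p.
  by have := DE k (Ordinal hr) p; rewrite /= addn0 Rem0 addr0.
have Doff n (p : M) : Xi p = 0 -> D n p <= 0.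
  move=> Xp; rewrite (divn_eq n r) (DE _ (Ordinal (ltn_pmod n hr))).
  rewrite Xp mulr0 add0r.
  by have /andP[_] := RemXi (Ordinal (ltn_pmod n hr)) p; rewrite Xp.
have Goff (a : contour_arc G) t : [set` arc_span a] t -> Xi (arc_path a t) = 0.
  case: a => a j ta; have [_ enum _] := hlift a.
  exact: (polar0 hZ ((enum t ta).1 j)).
have Dle m n (p : M) : (m <= n)%N -> D m p <= D n p.
  move=> mn; rewrite -(subnK mn); elim: (n - m)%N => // d ih.
  by apply: le_trans ih _; rewrite addSn; have /andP[] := Dmono (d + m)%N p.
have hflag : pairing_flag G Y g gv D.
  by split=> // n a t ta; exact: (Doff n _ (Goff a t ta)).
have hflagv := pairing_flagC hflag.
have hdetv n : (1 <= n)%N -> gram_det G Y chiv chi n != 0.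
  move=> n1; have := hdet n n1; rewrite /gram_det -det_tr.
  suff -> : (\matrix_(a < n, b < n) pairing G Y (chi a) (chiv b))^T =
    \matrix_(a < n, b < n) pairing G Y (chiv a) (chi b) by [].
  by apply/matrixP => a b; rewrite !mxE pairingC.
have hpsivl n : left_biorthogonal G Y (H0 gv (D n.+1)) (H0 g (D n)) (psiv n).
  have [psivn psivn0 orth] := hpsiv n; split=> // eta heta.
  by rewrite pairingC; exact: orth.
have span n : spans_mod (psi n) (H0 g (D n.+1)) (H0 g (D n)).
  exact: (biorthogonal_spans hflag hchi hchiv hdet (hpsi n)).
have spanv n : spans_mod (psiv n) (H0 gv (D n.+1)) (H0 gv (D n)).
  exact: (biorthogonal_spans hflagv hchiv hchi hdetv (hpsivl n)).
have hn0 n : pairing G Y (psi n) (psiv n) != 0.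
  exact: (biorthogonal_norm_neq0 hflag hchi hchiv hdet (hpsi n) (spanv n)).
have orthl n eta : H0 gv (D n) eta -> pairing G Y (psi n) eta = 0.
  by case: (hpsi n) => _ _; apply.
have orthr n eta : H0 g (D n) eta -> pairing G Y eta (psiv n) = 0.
  by case: (hpsiv n) => _ _; apply.
have orth n m : n != m -> pairing G Y (psi n) (psiv m) = 0.
  rewrite neq_ltn => /orP[nm|mn].
    by apply: orthr; apply: (flag_sub hflag nm); exact: (span n).1.
  by apply: orthl; apply: (flag_sub hflagv mn); exact: (spanv m).1.
have [hphi1 _ _] := hphi; have [hphiv1 _ _] := hphiv.
have Fu k : F k \in unitmx.
  exact: (leading_coef_unit hZ hsheet hflag Doff Dmul Goff hphi1
    (fun n => (span n).1) (fun n => (spanv n).1) orthr orth hn0 (hPdeg k) (hP k)).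
(* Transposition exchanges the roles of the two bundles. *)
have Fvu k : Fv k \in unitmx.
  rewrite -unitmx_tr (_ : (Fv k)^T = mxpoly_coef k (Pv k)^T); last first.
    by apply/matrixP => a b; rewrite !mxE.
  apply: (leading_coef_unit hZ hsheet hflagv Doff Dmul Goff hphiv1
    (fun n => (spanv n).1) (fun n => (span n).1)).
  - by move=> n eta heta; rewrite pairingC; exact: orthl.
  - by move=> n m nm; rewrite pairingC orth// eq_sym.
  - by move=> n; rewrite pairingC.
  - by move=> a b; rewrite mxE; exact: hPvdeg.
  - move=> z; have /(congr1 trmx) := hPv k z; rewrite trmx_mul.
    rewrite (_ : (Psiv_mx _ _ _ _)^T = Psi_mx sheet psiv k z); last first.
      by apply/matrixP => a b; rewrite !mxE.
    rewrite (_ : (Phiv_mx _ _ _)^T = Phi_mx sheet phiv z); last first.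
      by apply/matrixP => a b; rewrite !mxE.
    move=> ->; congr (_ *m _).
    by apply/matrixP => a b; rewrite !mxE.
have intP k l : weight_integrable g0 W (P k) (Pv l) /\
    weight_integral g0 W (P k) (Pv l) = if l == k then H l else 0.
  have ipsi (a b : 'I_r) : surface_integrable G
      (pairing_form Y (psi (k * r + a)%N) (psiv (l * r + b)%N)).
    pose N := maxn (k * r + a).+1 (l * r + b).+1.
    apply: (hconv N).
      by apply: (flag_sub hflag (leq_maxl _ _)); exact: (span _).1.
    by apply: (flag_sub hflagv (leq_maxr _ _)); exact: (spanv _).1.
  have [iW ->] :=
    weight_integral_pairing hZ hg0 hlift hsheet (hP k) (hPv l) ipsi.
  split=> //; apply/matrixP => a b; rewrite mxE.
  (* Uniqueness of the quotient and of the remainder in the division by r. *)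
  have idx (m n : nat) (x y : 'I_r) :
      (m * r + x == n * r + y)%N = (m == n) && (x == y).
    apply/eqP/andP => [E|[/eqP -> /eqP ->]//].
    have := congr1 (fun q => (q %/ r)%N) E.
    have := congr1 (fun q => (q %% r)%N) E.
    rewrite /= !modnMDl !modn_small// !divnMDl// !divn_small// !addn0.
    by move=> xy ->; split=> //; apply/eqP/val_inj.
  have [->|lk] := eqVneq l k; last first.
    by rewrite mxE orth// idx eq_sym (negPf lk).
  rewrite /H !mxE; have [->|ab] := eqVneq a b; first by rewrite mulr1n.
  by rewrite mulr0n orth// idx eqxx.
split; first by move=> n; split; [exact: span|exact: spanv].
split; first exact: intP.
split; first by move=> k; split; [exact: Fu|exact: Fvu].
split.
  move=> k; split; first exact: (mxpoly_monic_constl (hPdeg k) (Fu k)).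
  exact: (mxpoly_monic_constr (hPvdeg k) (Fvu k)).
move=> k l; have [iW eW] := intP k l.
have [iQ eQ] := weight_integral_const (invmx (F k)) (invmx (Fv l)) iW.
split; first exact: iQ.
apply: etrans eQ _; rewrite eW; have [->|lk] := eqVneq l k; first by [].
by rewrite mulmx0 mul0mx.
Qed.
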